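(* Consider the rubber Chaplygin ball in $\mathbb R^n$ rolling without slipping and twisting over a fixed $(n-1)$-dimensional sphere, i.e. the nonholonomic Lagrangian system $(SO(n)\times S^{n-1},L,\mathcal F^\pm)$ described in the context. Let $m=\mathbf I\omega=\mathbb I\omega+D\omega$ and let $$\mathcal G=\{(m,g,\gamma)\in T^*SO(n)\times S^{n-1}\mid \mathrm{pr}_{\mathfrak h_\gamma}\mathbf I^{-1}m=\mathrm{pr}_{\mathfrak h_\gamma}\omega=0\}.$$ Then the equations of motion on $\mathcal G$ are $$\dot m=[m,\omega]+\lambda_0,\qquad \dot g=g\cdot\omega,\qquad \dot\gamma=-\epsilon\,\omega\gamma,$$ where $\lambda_0\in\mathfrak h_\gamma$ is the solution of $$\mathbf I^{-1}([m,\omega]+\lambda_0)-\gamma\otimes\gamma\,\mathbf I^{-1}([m,\omega]+\lambda_0)-\mathbf I^{-1}([m,\omega]+\lambda_0)\,\gamma\otimes\gamma=0 .$$ The reduction of the left $SO(n)$-symmetry $a\cdot(\omega,\dot\gamma,g,\gamma)=(\omega,\dot\gamma,ag,\gamma)$, $a\in SO(n)$, induces a system on the space $$\mathcal G_0=\mathcal G/SO(n)=\{(m,\gamma)\in so(n)^*\times S^{n-1}\mid \mathrm{pr}_{\mathfrak h_\gamma}\omega=0\}$$ given by $$\dot m=[m,\omega]+\lambda_0,\qquad \dot\gamma=-\epsilon\,\omega\gamma .$$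
   Context: Vectors of $\mathbb R^n$ are columns, $(x,y)=x^Ty$, $x\otimes y=xy^T$, $x\wedge y=xy^T-yx^T$. Identify $so(n)\cong so(n)^*$ by $\langle X,Y\rangle=-\frac12\mathrm{tr}(XY)$. For $\gamma\in S^{n-1}$, $\mathfrak v_\gamma=\mathbb R^n\wedge\gamma\subset so(n)$, $\mathfrak h_\gamma=\mathfrak v_\gamma^\perp$, with orthogonal projections $\mathrm{pr}_{\mathfrak v_\gamma}\xi=\xi\,\gamma\otimes\gamma+\gamma\otimes\gamma\,\xi$ and $\mathrm{pr}_{\mathfrak h_\gamma}=\mathbb E-\mathrm{pr}_{\mathfrak v_\gamma}$, where $\mathbb E$ is the identity operator on $so(n)$. Setting. A ball of radius $\rho>0$ and mass (here denoted $m_b>0$), with mass center $C$ at its geometric center, rolls over a fixed sphere of radius $\sigma>0$ centered at the origin $O$: (i) over the outer surface of the fixed sphere; (ii) over the inner surface ($\sigma>\rho$); (iii) over the outer surface, the fixed sphere lying inside the rolling spherical shell ($\sigma<\rho$). In every sign $\pm$ take $+$ in case (i), $-$ in cases (ii), (iii). Put $\epsilon=\frac{\sigma}{\sigma\pm\rho}$, $D=m_b\rho^2$. The configuration is $(g,\mathbf r)$, $g\in SO(n)$ the rotation matrix (body frame to space frame), $\mathbf r=\overrightarrow{OC}$ with $(\mathbf r,\mathbf r)=(\sigma\pm\rho)^2$. Put $\omega=g^{-1}\dot g$, $\mathbf V=\dot{\mathbf r}$, $\mathbf\Gamma=\frac1{\sigma\pm\rho}\mathbf r$, $\gamma=g^{-1}\mathbf\Gamma\in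 S^{n-1}$; $(g,\gamma)$ may be used as coordinates instead of $(g,\mathbf r)$. The Lagrangian is $L=\frac12\langle\mathbb I\omega,\omega\rangle+\frac12m_b(\mathbf V,\mathbf V)$, with $\mathbb I:so(n)\to so(n)$ symmetric positive definite, and $\mathbf I=\mathbb I+D\mathbb E$. The no-slip and no-twist constraints define the distribution $$\mathcal F^\pm=\{(\omega,\mathbf V,g,\mathbf r)\mid \mathbf V=\pm\tfrac{\rho}{\sigma\pm\rho}\,g\omega g^{-1}\mathbf r,\ \mathrm{pr}_{\mathfrak h_\gamma}\omega=0\}.$$ Motions are the solutions of the Lagrange–d'Alembert equations: curves tangent to $\mathcal F^\pm$ along which $\frac{d}{dt}\frac{\partial L}{\partial\dot q}-\frac{\partial L}{\partial q}$ annihilates $\mathcal F^\pm$. The phase space $\mathcal F^\pm$ is identified with $\mathcal G$ via $(\omega,g,\gamma)\mapsto(m,g,\gamma)$, $m=\mathbf I\omega$, with $T^*SO(n)$ left-trivialized. *)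

(* Defs.v *)
From HB Require Import structures.
From mathcomp Require Import all_boot all_order all_algebra.
From mathcomp Require Import all_classical all_reals all_analysis.

Set Implicit Arguments.
Unset Strict Implicit.
Unset Printing Implicit Defensive.

Import Order.TTheory GRing.Theory Num.Theory.
Import numFieldNormedType.Exports.
Local Open Scope classical_set_scope.
Local Open Scope ring_scope.

Definition skew_defect (R : realType) (n : nat) (A : 'M[R]_n) : 'M[R]_n :=
  A + A^T.

Lemma skew_defect_is_linear (R : realType) (n : nat) :
  linear (@skew_defect R n).
Proof.
move=> a A B; rewrite /skew_defect linearD linearZ /= scalerDr.
by rewrite addrACA.
Qed.

HB.instance Definition _ (R : realType) (n : nat) :=
  GRing.isLinear.Build R 'M[R]_n 'M[R]_n _ (@skew_defect R n)
    (@skew_defect_is_linear R n).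

Definition so (R : realType) (n : nat) : {vspace 'M[R]_n} :=
  lker (linfun (@skew_defect R n)).

Lemma in_so (R : realType) (n : nat) (A : 'M[R]_n) :
  (A \in so R n) = (A^T == - A).
Proof. by rewrite memv_ker lfunE /= /skew_defect addrC addr_eq0. Qed.

(* so(n) as a vector space of its own; [vsval] is the inclusion in 'M[R]_n and
   [vsproj (so R n)] a linear retraction of it. *)
Notation soT R n := (subvs_of (so R n)).

Lemma lie_in_so (R : realType) (n : nat) (X Y : soT R n) :
  vsval X *m vsval Y - vsval Y *m vsval X \in so R n.
Proof.
have /eqP hX : (vsval X)^T == - vsval X by rewrite -in_so subvsP.
have /eqP hY : (vsval Y)^T == - vsval Y by rewrite -in_so subvsP.
by rewrite in_so linearB /= !trmx_mul hX hY !mulNmx !mulmxN !opprK opprB.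
Qed.

Definition lie (R : realType) (n : nat) (X Y : soT R n) : soT R n :=
  Subvs (lie_in_so X Y).

Definition ip (R : realType) (n : nat) (X Y : 'M[R]_n) : R :=
  - (2^-1 * \tr (X *m Y)).

Definition dot (R : realType) (n : nat) (x y : 'cV[R]_n) : R :=
  (x^T *m y) 0 0.

Definition tensor (R : realType) (n : nat) (x y : 'cV[R]_n) : 'M[R]_n :=
  x *m y^T.

Definition wedge (R : realType) (n : nat) (x y : 'cV[R]_n) : 'M[R]_n :=
  tensor x y - tensor y x.

Definition SO (R : realType) (n : nat) : set 'M[R]_n :=
  [set g | g^T *m g = 1%:M /\ \det g = 1].

Definition unit_sphere (R : realType) (n : nat) : set 'cV[R]_n :=
  [set x | dot x x = 1].

(* The orthogonal complement in so(n) of v_gamma = { x /\ gamma | x in R^n }. *)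
Definition h_space (R : realType) (n : nat) (gam : 'cV[R]_n) : set (soT R n) :=
  [set X | forall x : 'cV[R]_n, ip (vsval X) (wedge x gam) = 0].

Definition pr_v (R : realType) (n : nat) (gam : 'cV[R]_n) (X : 'M[R]_n) :
  'M[R]_n := X *m tensor gam gam + tensor gam gam *m X.

Definition pr_h (R : realType) (n : nat) (gam : 'cV[R]_n) (X : 'M[R]_n) :
  'M[R]_n := X - pr_v gam X.

(* [Outer]: over the outer surface; [Inner]: over the inner surface;
   [OuterShell]: over the outer surface of a sphere lying inside the rolling
   spherical shell. *)
Variant rolling_case : Type := Outer | Inner | OuterShell.

Record rolling_ball (R : realType) (n : nat) : Type := RollingBall {
  rolling : rolling_case;
  sigma : R;
  rho : R;
  mass : R;
  inertia : 'End(soT R n) }.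

Definition admissible (R : realType) (n : nat) (b : rolling_ball R n) : Prop :=
  [/\ [/\ 0 < sigma b, 0 < rho b & 0 < mass b],
      match rolling b with
      | Outer => True
      | Inner => rho b < sigma b
      | OuterShell => sigma b < rho b
      end,
      (forall X Y : soT R n,
        ip (vsval (inertia b X)) (vsval Y) =
        ip (vsval X) (vsval (inertia b Y))) &
      (forall X : soT R n, X != 0 -> 0 < ip (vsval (inertia b X)) (vsval X))].

Definition pm (R : realType) (n : nat) (b : rolling_ball R n) : R :=
  if rolling b is Outer then 1 else -1.

(* sigma +/- rho; negative in the case [OuterShell]. *)
Definition dist (R : realType) (n : nat) (b : rolling_ball R n) : R :=
  sigma b + pm b * rho b.

Definition eps (R : realType) (n : nat) (b : rolling_ball R n) : R :=
  sigma b / dist b.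

Definition Dcst (R : realType) (n : nat) (b : rolling_ball R n) : R :=
  mass b * rho b ^+ 2.

Definition total_inertia (R : realType) (n : nat) (b : rolling_ball R n) :
  'End(soT R n) := (inertia b + Dcst b *: \1)%VF.

Definition omega_of_momentum (R : realType) (n : nat) (b : rolling_ball R n)
  (m : soT R n) : soT R n := ((total_inertia b)^-1)%VF m.

(* Ambient space of the pairs (g, r), and also of their velocities. *)
Notation cfg R n := ('M[R]_n * 'cV[R]_n)%type.

Definition config (R : realType) (n : nat) (b : rolling_ball R n) :
  set (cfg R n) :=
  [set q | SO q.1 /\ dot q.2 q.2 = dist b ^+ 2].

(* T_g SO(n) = g so(n). *)
Definition config_tangent (R : realType) (n : nat) (q : cfg R n) :
  set (cfg R n) :=
  [set v | invmx q.1 *m v.1 \in so R n /\ dot q.2 v.2 = 0].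

(* g^-1 g'; the retraction [vsproj] does nothing on vectors tangent to SO(n). *)
Definition omega_of (R : realType) (n : nat) (q v : cfg R n) : soT R n :=
  vsproj (so R n) (invmx q.1 *m v.1).

Definition gamma_of (R : realType) (n : nat)
  (b : rolling_ball R n) (q : cfg R n) : 'cV[R]_n :=
  invmx q.1 *m ((dist b)^-1 *: q.2).

Definition lagrangian (R : realType) (n : nat)
  (b : rolling_ball R n) (q v : cfg R n) : R :=
  2^-1 * ip (vsval (inertia b (omega_of q v))) (vsval (omega_of q v)) +
  2^-1 * mass b * dot v.2 v.2.

Definition rubber_distribution (R : realType) (n : nat)
  (b : rolling_ball R n) (q : cfg R n) : set (cfg R n) :=
  [set v | [/\ config_tangent q v,
               v.2 = (pm b * (rho b / dist b)) *:
                     (q.1 *m vsval (omega_of q v) *m invmx q.1 *m q.2) &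
               pr_h (gamma_of b q) (vsval (omega_of q v)) = 0]].

Definition C2_on (R : realType) (V W : normedModType R) (U : set V)
  (f : V -> W) : Prop :=
  forall x, U x ->
    [/\ differentiable f x,
        (forall v, differentiable ('D_v f) x) &
        (forall v w, {for x, continuous ('D_w ('D_v f))})].

(* phi : U -> Q is the inverse of a local coordinate system on the
   configuration manifold Q: an injective map whose differential at each
   point is an isomorphism onto the tangent space of Q. *)
Definition local_parametrization (R : realType) (n : nat) (b : rolling_ball R n)
  (N : nat) (U : set 'rV[R]_N) (phi : 'rV[R]_N -> cfg R n) : Prop :=
  [/\ open U /\ C2_on U phi,
      (forall x, U x -> config b (phi x)),
      (forall x y, U x -> U y -> phi x = phi y -> x = y),
      (forall x w, U x -> 'D_w phi x = 0 -> w = 0) &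
      (forall x, U x ->
        config_tangent (phi x) = range (fun w => 'D_w phi x))].

Definition local_lagrangian (R : realType) (n : nat)
  (b : rolling_ball R n) (N : nat)
  (phi : 'rV[R]_N -> cfg R n) (x xdot : 'rV[R]_N) : R :=
  lagrangian b (phi x) ('D_xdot phi x).

(* i-th component of d/dt (dl/dxdot) - dl/dx along the curve x, at time t. *)
Definition euler_lagrange (R : realType) (N : nat)
  (l : 'rV[R]_N -> 'rV[R]_N -> R) (x : R -> 'rV[R]_N) (t : R) (i : 'I_N) : R :=
  'D_1 (fun s : R => 'D_(delta_mx 0 i) (l (x s)) (derive1 x s) : R) t -
  'D_(delta_mx 0 i) (fun y => l y (derive1 x t)) (x t).

Definition twice_derivable (R : realType) (V : normedModType R) (f : R -> V)
  (t : R) : Prop := derivable f t 1 /\ derivable (derive1 f) t 1.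

(* In any local coordinates x on the configuration manifold, the Euler-Lagrange
   covector of the curve q at time t vanishes on the distribution.  A coordinate
   representation of a twice derivable curve is twice derivable, hence this
   requirement on x does not restrict the definition. *)
Definition lagrange_dAlembert (R : realType) (n : nat) (b : rolling_ball R n)
  (q : R -> cfg R n) (t : R) : Prop :=
  forall (N : nat) (U : set 'rV[R]_N) (phi : 'rV[R]_N -> cfg R n)
         (x : R -> 'rV[R]_N),
    local_parametrization b U phi ->
    (\forall s \near t, [/\ U (x s), phi (x s) = q s & twice_derivable x s]) ->
    forall w : 'rV[R]_N, rubber_distribution b (q t) ('D_w phi (x t)) ->
      \sum_(i < N) euler_lagrange (local_lagrangian b phi) x t i * w 0 i = 0.

Definition motion (R : realType) (n : nat)
  (b : rolling_ball R n) (J : set R)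
  (q : R -> cfg R n) : Prop :=
  forall t, J t ->
    [/\ config b (q t), twice_derivable q t,
        rubber_distribution b (q t) (derive1 q t) & lagrange_dAlembert b q t].

Definition in_G0 (R : realType) (n : nat)
  (b : rolling_ball R n) (m : soT R n)
  (gam : 'cV[R]_n) : Prop :=
  unit_sphere gam /\ pr_h gam (vsval (omega_of_momentum b m)) = 0.

Definition in_G (R : realType) (n : nat)
  (b : rolling_ball R n) (m : soT R n)
  (g : 'M[R]_n) (gam : 'cV[R]_n) : Prop :=
  [/\ SO g, unit_sphere gam & pr_h gam (vsval (omega_of_momentum b m)) = 0].

Definition is_lambda0 (R : realType) (n : nat)
  (b : rolling_ball R n) (m : soT R n)
  (gam : 'cV[R]_n) (lam : soT R n) : Prop :=
  h_space gam lam /\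
  let W := vsval (((total_inertia b)^-1)%VF
                    (lie m (omega_of_momentum b m) + lam)) in
  W - tensor gam gam *m W - W *m tensor gam gam = 0.

Definition field_G (R : realType) (n : nat)
  (b : rolling_ball R n) (m : soT R n)
  (g : 'M[R]_n) (gam : 'cV[R]_n)
  (dm : soT R n) (dg : 'M[R]_n) (dgam : 'cV[R]_n) : Prop :=
  let omega := omega_of_momentum b m in
  exists lam, [/\ is_lambda0 b m gam lam,
                  dm = lie m omega + lam,
                  dg = g *m vsval omega &
                  dgam = - eps b *: (vsval omega *m gam)].

Definition field_G0 (R : realType) (n : nat)
  (b : rolling_ball R n) (m : soT R n)
  (gam : 'cV[R]_n) (dm : soT R n) (dgam : 'cV[R]_n) : Prop :=
  let omega := omega_of_momentum b m in
  exists lam, [/\ is_lambda0 b m gam lam,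
                  dm = lie m omega + lam &
                  dgam = - eps b *: (vsval omega *m gam)].

Definition so_derive (R : realType) (n : nat) (m : R -> soT R n) (t : R)
  (dm : soT R n) : Prop :=
  is_derive t (1 : R) (fun s => vsval (m s)) (vsval dm).

Definition solution_G (R : realType) (n : nat)
  (b : rolling_ball R n) (J : set R)
  (m : R -> soT R n) (g : R -> 'M[R]_n) (gam : R -> 'cV[R]_n) : Prop :=
  forall t, J t -> in_G b (m t) (g t) (gam t) /\
    exists dm dg dgam,
      [/\ field_G b (m t) (g t) (gam t) dm dg dgam, so_derive m t dm,
          is_derive t (1 : R) g dg & is_derive t (1 : R) gam dgam].

Definition solution_G0 (R : realType) (n : nat)
  (b : rolling_ball R n) (J : set R)
  (m : R -> soT R n) (gam : R -> 'cV[R]_n) : Prop :=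
  forall t, J t -> in_G0 b (m t) (gam t) /\
    exists dm dgam,
      [/\ field_G0 b (m t) (gam t) dm dgam, so_derive m t dm &
          is_derive t (1 : R) gam dgam].

(* Velocities at t = 0 of curves lying in G, resp. in G0. *)
Definition tangent_G (R : realType) (n : nat)
  (b : rolling_ball R n) (m : soT R n)
  (g : 'M[R]_n) (gam : 'cV[R]_n)
  (dm : soT R n) (dg : 'M[R]_n) (dgam : 'cV[R]_n) : Prop :=
  exists (mu : R -> soT R n) (h : R -> 'M[R]_n) (c : R -> 'cV[R]_n),
    [/\ forall t, in_G b (mu t) (h t) (c t),
        [/\ mu 0 = m, h 0 = g & c 0 = gam],
        so_derive mu 0 dm,
        is_derive (0 : R) (1 : R) h dg & is_derive (0 : R) (1 : R) c dgam].

Definition tangent_G0 (R : realType) (n : nat)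
  (b : rolling_ball R n) (m : soT R n)
  (gam : 'cV[R]_n) (dm : soT R n) (dgam : 'cV[R]_n) : Prop :=
  exists (mu : R -> soT R n) (c : R -> 'cV[R]_n),
    [/\ forall t, in_G0 b (mu t) (c t),
        mu 0 = m /\ c 0 = gam,
        so_derive mu 0 dm & is_derive (0 : R) (1 : R) c dgam].

(* The action a . (g, r) = (a g, a r) of SO(n); in the coordinates (g, gamma) it
   is (a g, gamma). It is linear, hence it is also its own tangent map. *)
Definition left_act (R : realType) (n : nat) (a : 'M[R]_n) (q : cfg R n) :
  cfg R n := (a *m q.1, a *m q.2).

(* Main.v *)
Require Import Defs.
From HB Require Import structures.
From mathcomp Require Import all_boot all_order all_algebra.
From mathcomp Require Import all_classical all_reals all_analysis.
From mathcomp Require Import perm ring.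

(* In any local coordinates the Euler-Lagrange covector of a curve (g, r) with
   angular velocity om = g^-1 g' pairs with a velocity (g Om, v) to
   <I om' - [I om, om], Om> + m_b (r'', v); the second derivatives of the chart
   drop out by Schwarz' theorem.  On the distribution Om = x /\ gamma and
   v = +/- rho g Om gamma, and because om is itself of the form x /\ gamma the
   last term equals D <om', Om>.  So Lagrange-d'Alembert says that m' - [m, om]
   is orthogonal to all x /\ gamma, i.e. lies in h_gamma, while the condition
   on lambda_0 is pr_h om' = 0, the derivative of the constraint pr_h om = 0: the
   terms with gamma' = - eps om gamma cancel.

   To extract this from the coordinate definition one needs charts.  Put
   P = 1 - A with A skew, p = r0 + u with u orthogonal to r0, and d = |r0|; then
   (A, u) |-> (g0 (2 P^-1 - 1), 2 d^2 p / |p|^2 - r0), i.e. a Cayley transform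
   and an inversion, is a global rational parametrization of a neighbourhood of
   (g0, r0), with rational inverse.  Existence and uniqueness of lambda_0 is the
   injectivity of X |-> I (pr_v X) - pr_h X. *)

Set Implicit Arguments.
Unset Strict Implicit.
Unset Printing Implicit Defensive.

Import Order.TTheory GRing.Theory Num.Theory.
Import numFieldNormedType.Exports.
Local Open Scope classical_set_scope.
Local Open Scope ring_scope.

(** * Directional derivatives of differentiable maps *)

Section DirectionalDerivative.
Variables (R : realType) (V : normedModType R).

(** The principle quantifies over all charts, and this cuts both ways. From a solution to a motion
    the chart is arbitrary, so the covector must be computed in general local coordinates. From a
    motion to a solution the universal statement could be vacuous, so a chart must be produced in
    which the given curve has twice derivable coordinates near the instant; this requires the
    inverse of the chart, and a rational inverse is twice derivable along the curve without any
    inverse function theorem. The directional derivative 'D_v is a total function, so an equation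
    between derivatives says nothing about their existence, and the chain rule wants
    differentiability rather than derivability in one direction. [hasD] carries the value and the
    differentiability together, and each rule propagates both. *)

Definition hasD {W : normedModType R} (f : V -> W) (x v : V) (d : W) : Prop :=
  differentiable f x /\ 'D_v f x = d.

Lemma hasDE (W : normedModType R) (f : V -> W) x v :
  differentiable f x -> hasD f x v ('D_v f x).
Proof. by []. Qed.

Lemma hasD_eq (W : normedModType R) (f : V -> W) x v d d' :
  hasD f x v d -> d = d' -> hasD f x v d'.
Proof. by move=> h <-. Qed.

Lemma hasD_ext (W : normedModType R) (f g : V -> W) x v d :
  f =1 g -> hasD f x v d -> hasD g x v d.
Proof. by move=> /funext ->. Qed.

Lemma hasD_cst (W : normedModType R) (c : W) x v : hasD (fun=> c) x v 0.
Proof. by split; [exact: differentiable_cst | exact: derive_cst]. Qed.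

Lemma hasD_id x v : hasD (fun y : V => y) x v v.
Proof. by split; [exact: ex_diff | exact: derive_id]. Qed.

Lemma hasDD (W : normedModType R) (f g : V -> W) x v df dg :
  hasD f x v df -> hasD g x v dg ->
  hasD (fun y => f y + g y) x v (df + dg).
Proof.
move=> [f1 <-] [g1 <-]; split; first exact: differentiableD.
by apply: deriveD; exact: diff_derivable.
Qed.

Lemma hasDN (W : normedModType R) (f : V -> W) x v df :
  hasD f x v df -> hasD (fun y => - f y) x v (- df).
Proof.
move=> [f1 <-]; split; first exact: differentiableN.
by apply: deriveN; exact: diff_derivable.
Qed.

Lemma hasDB (W : normedModType R) (f g : V -> W) x v df dg :
  hasD f x v df -> hasD g x v dg ->
  hasD (fun y => f y - g y) x v (df - dg).
Proof. by move=> hf hg; apply: hasDD => //; exact: hasDN. Qed.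

Lemma hasDZ (W : normedModType R) (k : R) (f : V -> W) x v df :
  hasD f x v df -> hasD (fun y => k *: f y) x v (k *: df).
Proof.
move=> [f1 <-]; split; first exact: differentiableZ.
by apply: deriveZ; exact: diff_derivable.
Qed.

Lemma hasDM (f g : V -> R) x v df dg :
  hasD f x v df -> hasD g x v dg ->
  hasD (fun y => f y * g y) x v (df * g x + f x * dg).
Proof.
move=> [f1 <-] [g1 <-]; split; first exact: differentiableM.
rewrite addrC [_ * g x]mulrC.
by apply: deriveM; exact: diff_derivable.
Qed.

Lemma hasD_sum (W : normedModType R) (I : Type) (s : seq I) (P : pred I)
    (f : I -> V -> W) x v df :
  (forall i, hasD (f i) x v (df i)) ->
  hasD (fun y => \sum_(i <- s | P i) f i y) x v (\sum_(i <- s | P i) df i).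
Proof.
move=> h; elim: s => [|i s IHs].
  rewrite big_nil; apply: hasD_ext (hasD_cst 0 x v) => y.
  by rewrite big_nil.
rewrite big_cons; case: ifP => Pi.
  by apply: hasD_ext (hasDD (h i) IHs) => y; rewrite big_cons Pi.
by apply: hasD_ext IHs => y; rewrite big_cons Pi.
Qed.

Lemma differentiable_prod (I : Type) (s : seq I) (P : pred I)
    (f : I -> V -> R) x :
  (forall i, differentiable (f i) x) ->
  differentiable (fun y => \prod_(i <- s | P i) f i y) x.
Proof.
move=> h; elim: s => [|i s IHs].
  have -> : (fun y => \prod_(i <- [::] | P i) f i y) = cst (1 : R).
    by apply/funext => y; rewrite big_nil.
  exact: differentiable_cst.
have -> : (fun y => \prod_(j <- i :: s | P j) f j y) =
    fun y => if P i then f i y * \prod_(j <- s | P j) f j y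
             else \prod_(j <- s | P j) f j y.
  by apply/funext => y; rewrite big_cons.
by case: (P i) => //; exact: differentiableM.
Qed.

Lemma hasD_scalel (W : normedModType R) (f : V -> R) (w : W) x v df :
  hasD f x v df -> hasD (fun y => f y *: w) x v (df *: w).
Proof.
move=> [f1 <-]; have h : differentiable (fun y => f y *: w) x.
  exact: differentiableZl.
split=> //; rewrite !deriveE //.
by move: (congr1 (fun F : V -> W => F v) (diffZl w f1)).
Qed.

Lemma hasD_comp (W X : normedModType R) (f : V -> W) (g : W -> X) x v df :
  hasD f x v df -> differentiable g (f x) ->
  hasD (fun y => g (f y)) x v ('D_df g (f x)).
Proof.
move=> [f1 <-] g1; have h : differentiable (g \o f) x.
  exact: differentiable_comp.
by split=> //; rewrite -/(g \o f) !deriveE // diff_comp.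
Qed.

Lemma hasD_pair (W X : normedModType R) (f : V -> W) (g : V -> X) x v df dg :
  hasD f x v df -> hasD g x v dg ->
  hasD (fun y => (f y, g y)) x v (df, dg).
Proof.
move=> [f1 <-] [g1 <-].
have h : differentiable (fun y => (f y, g y)) x by exact: differentiable_pair.
by split=> //; rewrite !deriveE // diff_pair.
Qed.

Lemma hasD_mx m n (f : V -> 'M[R]_(m, n)) x v (df : 'M[R]_(m, n)) :
  (forall i j, hasD (fun y => f y i j : R) x v (df i j)) -> hasD f x v df.
Proof.
move=> h.
rewrite [df]matrix_sum_delta.
have -> : f = fun y => \sum_i \sum_j f y i j *: delta_mx i j.
  by apply/funext => y; rewrite -matrix_sum_delta.
apply: hasD_sum => i; apply: hasD_sum => j.
exact: hasD_scalel.
Qed.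


Lemma hasD_linear (W X : normedModType R) (g : {linear W -> X}) (f : V -> W)
    x v df :
  continuous g -> hasD f x v df -> hasD (fun y => g (f y)) x v (g df).
Proof.
move=> gc hf; have gd := linear_differentiable (f x) gc.
apply: hasD_eq (hasD_comp hf gd) _.
by rewrite deriveE // diff_lin.
Qed.

Lemma hasD_coord m n (f : V -> 'M[R]_(m, n)) x v (df : 'M[R]_(m, n)) i j :
  hasD f x v df -> hasD (fun y => f y i j : R) x v (df i j).
Proof.
move=> [f1 <-]; have gd := differentiable_coord (f x) i j; split.
  exact: (differentiable_comp (g := fun N : 'M[R]_(m, n) => N i j : R)).
have hd : derivable f x v by exact: diff_derivable.
by rewrite (derive_mx hd) mxE.
Qed.

Lemma hasD_mulmx m n p (f : V -> 'M[R]_(m, n)) (g : V -> 'M[R]_(n, p)) x v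
    df dg :
  hasD f x v df -> hasD g x v dg ->
  hasD (fun y => f y *m g y) x v (df *m g x + f x *m dg).
Proof.
move=> hf hg; apply: hasD_mx => i j.
apply: (@hasD_ext _ (fun y => \sum_k f y i k * g y k j : R)).
  by move=> y; rewrite mxE.
apply: hasD_eq (hasD_sum _ _ (df := fun k => df i k * g x k j + f x i k * dg k j) _) _.
  by move=> k; apply: hasDM; exact: hasD_coord.
by rewrite big_split !mxE.
Qed.

Lemma hasD_trmx m n (f : V -> 'M[R]_(m, n)) x v df :
  hasD f x v df -> hasD (fun y => (f y)^T) x v df^T.
Proof.
move=> hf; apply: hasD_mx => i j; rewrite mxE.
by apply: hasD_ext (hasD_coord j i hf) => y; rewrite mxE.
Qed.

Lemma hasD_scale m n (c : V -> R) (f : V -> 'M[R]_(m, n)) x v dc df :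
  hasD c x v dc -> hasD f x v df ->
  hasD (fun y => c y *: f y) x v (dc *: f x + c x *: df).
Proof.
move=> hc hf; apply: hasD_mx => i j; rewrite !mxE.
apply: (@hasD_ext _ (fun y => c y * f y i j : R)).
  by move=> y; rewrite mxE.
by apply: hasDM => //; exact: hasD_coord.
Qed.

(** Cramer's rule makes the inverse rational in the entries. Invertibility is asked at every point
    because [invmx] returns its argument on singular matrices. *)
Lemma differentiable_invmx n (f : V -> 'M[R]_n) x :
  (forall y, f y \in unitmx) -> differentiable f x ->
  differentiable (fun y => invmx (f y)) x.
Proof.
move=> fu hf.
have fc i j : differentiable (fun y => f y i j : R) x.
  by have [] := hasD_coord i j (hasDE 0 hf).
(* Stated for every size: it serves for [f] itself and for the minors in its adjugate. *)
have cdet k (g : V -> 'M[R]_k) : (forall i j, differentiable (fun y => g y i j : R) x) ->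
    differentiable (fun y => \det (g y) : R) x.
  move=> hg; have h (s : 'S_k) : hasD (fun y => (-1) ^+ s * \prod_i g y i (s i) : R) x 0
      ('D_0 (fun y => (-1) ^+ s * \prod_i g y i (s i) : R) x).
    apply: hasDE; apply: differentiableM; first exact: differentiable_cst.
    exact: differentiable_prod.
  by have [] := hasD_sum (index_enum _) xpredT h.
have -> : (fun y => invmx (f y)) = fun y => (\det (f y))^-1 *: \adj (f y).
  by apply/funext => y; rewrite /invmx fu.
have dd : differentiable (fun y => (\det (f y))^-1 : R) x.
  apply: differentiableV; first exact: cdet.
  by move: (fu x); rewrite unitmxE unitfE.
(* Only differentiability is wanted: in the direction 0 the derivative is 0 for free. *)
have da : hasD (fun y => \adj (f y)) x 0 0.
  apply: hasD_mx => i j; rewrite mxE.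
  apply: (@hasD_ext _ (fun y => (-1) ^+ (j + i) * \det (row' j (col' i (f y))) : R)).
    by move=> y; rewrite mxE.
  split; last exact: derive0.
  apply: differentiableM; first exact: differentiable_cst.
  apply: cdet => k l.
  suff -> : (fun y => row' j (col' i (f y)) k l) =
      fun y => f y (lift j k) (lift i l) by [].
  by apply/funext => y; rewrite !mxE.
by have [] := hasD_scale (hasDE 0 dd) da.
Qed.

(** Differentiate the product of the inverse with [f], which is constant, and solve for the
    derivative of the inverse, whose existence is already known. *)
Lemma hasD_invmx n (f : V -> 'M[R]_n) x v df :
  (forall y, f y \in unitmx) -> hasD f x v df ->
  hasD (fun y => invmx (f y)) x v (- (invmx (f x) *m df *m invmx (f x))).
Proof.
move=> fu hf; have di := differentiable_invmx fu hf.1.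
apply: hasD_eq (hasDE v di) _.
have [_] := hasD_mulmx (hasDE v di) hf.
have -> : (fun y => invmx (f y) *m f y) = cst 1%:M.
  by apply/funext => y; rewrite mulVmx.
rewrite derive_cst => /esym/eqP; rewrite addr_eq0 => /eqP /(congr1 (mulmx^~ (invmx (f x)))).
by move=> /= ; rewrite mulmxK // mulNmx.
Qed.

End DirectionalDerivative.

(** * Continuity of linear maps on matrices and pairs *)

Section LinearContinuity.
Variables (R : realType) (W : normedModType R).

Lemma linear_mx_continuous m n (g : {linear 'M[R]_(m, n) -> W}) : continuous g.
Proof.
move=> M; apply: differentiable_continuous.
have -> : (g : _ -> _) = fun A : 'M[R]_(m, n) => \sum_i \sum_j A i j *: g (delta_mx i j).
  apply/funext => A; rewrite {1}[A]matrix_sum_delta linear_sum; apply: eq_bigr => i _.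
  by rewrite linear_sum; apply: eq_bigr => j _; rewrite linearZ.
have h i j : hasD (fun A : 'M[R]_(m, n) => A i j *: g (delta_mx i j)) M 0 (0 *: g (delta_mx i j)).
  apply: hasD_scalel; split; last by rewrite derive0.
  exact: differentiable_coord.
by have [] := hasD_sum (index_enum _) xpredT (fun i => hasD_sum (index_enum _) xpredT (h i)).
Qed.

End LinearContinuity.

Lemma linear_pair_continuous (R : realType) (U V W : normedModType R)
    (g : {linear (U * V)%type -> W}) :
  continuous (fun u => g (u, 0)) -> continuous (fun v => g (0, v)) ->
  continuous g.
Proof.
move=> g1 g2 x.
have -> : (g : _ -> _) = fun y => g (y.1, 0) + g (0, y.2).
  apply/funext => -[u v]; rewrite -linearD /=; congr (g _).
  by congr pair; rewrite /= ?addr0 ?add0r.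
apply: cvgD.
  by apply: (@continuous_comp _ _ _ fst (fun u => g (u, 0))); [exact: cvg_fst|exact: g1].
by apply: (@continuous_comp _ _ _ snd (fun u => g (0, u))); [exact: cvg_snd|exact: g2].
Qed.

Section Curves.
Variables (R : realType) (W : normedModType R).

Lemma is_derive_hasD (f : R -> W) (t : R) (d : W) :
  is_derive t (1 : R) f d <-> hasD f t 1 d.
Proof.
split=> [[f1 <-]|[f1 <-]]; first by split=> //; exact/derivable1_diffP.
by apply: DeriveDef => //; exact/derivable1_diffP.
Qed.

Lemma derive1_hasD (f : R -> W) (t : R) (d : W) : hasD f t 1 d -> derive1 f t = d.
Proof. by rewrite derive1E => -[]. Qed.

Lemma hasD_derive1 (f : R -> W) (t : R) :
  derivable f t 1 -> hasD f t 1 (derive1 f t).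
Proof. by rewrite derive1E => h; split=> //; exact/derivable1_diffP. Qed.

Lemma hasD_near (f g : R -> W) (t : R) (d : W) :
  (\forall s \near t, f s = g s) -> hasD f t 1 d -> hasD g t 1 d.
Proof.
by move=> fg /is_derive_hasD h; apply/is_derive_hasD; exact: near_eq_is_derive h.
Qed.

End Curves.

(** * Maps of class C^k *)

Section ContinuousDifferentiability.
Variables (R : realType) (V : normedModType R).

(** Iterated directional derivatives remain maps from [V] to the same [W], so no norm on a space of
    linear maps is involved. *)
Fixpoint Ck (k : nat) (W : normedModType R) (f : V -> W) : Prop :=
  if k is k'.+1 then
    (forall x, differentiable f x) /\ forall v, Ck k' (fun x => 'D_v f x)
  else continuous f.

Lemma CkS_diff k (W : normedModType R) (f : V -> W) x v :
  Ck k.+1 f -> hasD f x v ('D_v f x).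
Proof. by case=> h _; exact: hasDE. Qed.

Lemma CkW k (W : normedModType R) (f : V -> W) : Ck k.+1 f -> Ck k f.
Proof.
elim: k W f => [|k IHk] W f [fd fD].
  by move=> x; exact: differentiable_continuous.
by split=> // v; exact: IHk.
Qed.

Lemma CkS k (W : normedModType R) (f : V -> W) (D : V -> V -> W) :
  (forall x v, hasD f x v (D v x)) -> (forall v, Ck k (D v)) -> Ck k.+1 f.
Proof.
move=> h hD; split=> [x|v]; first by case: (h x 0).
by have -> : (fun x => 'D_v f x) = D v by apply/funext => x; case: (h x v).
Qed.

Lemma Ck_cst k (W : normedModType R) (c : W) : Ck k (fun=> c : W).
Proof.
elim: k c => [|k IHk] c; first by move=> x; exact: cvg_cst.
by apply: (CkS (D := fun _ _ => 0)) => // x v; exact: hasD_cst.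
Qed.

Lemma CkD k (W : normedModType R) (f g : V -> W) :
  Ck k f -> Ck k g -> Ck k (fun x => f x + g x).
Proof.
elim: k f g => [|k IHk] f g; first by move=> hf hg x; exact: (cvgD (hf x) (hg x)).
move=> hf hg; apply: (CkS (D := fun v x => 'D_v f x + 'D_v g x)).
  by move=> x v; exact: (hasDD (CkS_diff x v hf) (CkS_diff x v hg)).
by move=> v; apply: IHk; [exact: (proj2 hf v)|exact: (proj2 hg v)].
Qed.

Lemma Ck_linear k (W X : normedModType R) (g : {linear W -> X}) (f : V -> W) :
  continuous g -> Ck k f -> Ck k (fun x => g (f x)).
Proof.
move=> gc; elim: k f => [|k IHk] f.
  by move=> hf x; apply: (@continuous_comp _ _ _ f g); [exact: hf|exact: gc].
move=> hf; apply: (CkS (D := fun v x => g ('D_v f x))).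
  by move=> x v; exact: (hasD_linear gc (CkS_diff x v hf)).
by move=> v; apply: IHk; exact: (proj2 hf v).
Qed.

Lemma CkN k (W : normedModType R) (f : V -> W) : Ck k f -> Ck k (fun x => - f x).
Proof.
elim: k f => [|k IHk] f; first by move=> hf x; exact: (cvgN (hf x)).
move=> hf; apply: (CkS (D := fun v x => - 'D_v f x)).
  by move=> x v; exact: (hasDN (CkS_diff x v hf)).
by move=> v; apply: IHk; exact: (proj2 hf v).
Qed.

Lemma Ck_pair k (W X : normedModType R) (f : V -> W) (g : V -> X) :
  Ck k f -> Ck k g -> Ck k (fun x => (f x, g x)).
Proof.
elim: k f g => [|k IHk] f g; first by move=> hf hg x; apply: cvg_pair; [exact: hf|exact: hg].
move=> hf hg; apply: (CkS (D := fun v x => ('D_v f x, 'D_v g x))).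
  by move=> x v; exact: (hasD_pair (CkS_diff x v hf) (CkS_diff x v hg)).
by move=> v; apply: IHk; [exact: (proj2 hf v)|exact: (proj2 hg v)].
Qed.

Lemma Ck_mulmx k m n p (f : V -> 'M[R]_(m, n)) (g : V -> 'M[R]_(n, p)) :
  Ck k f -> Ck k g -> Ck k (fun x => f x *m g x).
Proof.
elim: k f g => [|k IHk] f g.
  move=> hf hg x.
  pose h (A : 'M[R]_(m, n) * 'M[R]_(n, p)) : 'M[R]_(m, p) := A.1 *m A.2.
  apply: (@continuous_comp _ _ _ (fun y => (f y, g y)) h).
    exact: (Ck_pair (k := 0) hf hg x).
  apply: differentiable_continuous.
  have d1 A : hasD (fst : 'M[R]_(m, n) * 'M[R]_(n, p) -> _) A 0 0.
    split; last exact: derive0.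
    by apply: linear_differentiable => ?; exact: cvg_fst.
  have d2 A : hasD (snd : 'M[R]_(m, n) * 'M[R]_(n, p) -> _) A 0 0.
    split; last exact: derive0.
    by apply: linear_differentiable => ?; exact: cvg_snd.
  by have [] := hasD_mulmx (d1 (f x, g x)) (d2 (f x, g x)).
move=> hf hg; apply: (CkS (D := fun v x => 'D_v f x *m g x + f x *m 'D_v g x)).
  by move=> x v; exact: (hasD_mulmx (CkS_diff x v hf) (CkS_diff x v hg)).
move=> v; apply: CkD; apply: IHk; do ?exact: CkW; [exact: (proj2 hf v)|exact: (proj2 hg v)].
Qed.

(** The derivative of the inverse contains the inverse itself, so regularity bootstraps from one
    level to the next. The shift to [k.+1] is there because continuity, the bottom level, is
    obtained from differentiability. *)
Lemma Ck_invmx k n (f : V -> 'M[R]_n) : (forall x, f x \in unitmx) ->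
  Ck k.+1 f -> Ck k.+1 (fun x => invmx (f x)).
Proof.
move=> fu; elim: k => [|k IHk] hf.
  have fi : Ck 0 (fun x => invmx (f x)).
    move=> x; apply: differentiable_continuous; apply: differentiable_invmx => //.
    exact: hf.1.
  apply: CkS (fun x v => hasD_invmx fu (CkS_diff x v hf)) _ => v.
  by apply: CkN; do !apply: Ck_mulmx => //; exact: (proj2 hf v).
have fi := IHk (CkW hf).
apply: CkS (fun x v => hasD_invmx fu (CkS_diff x v hf)) _ => v.
by apply: CkN; do !apply: Ck_mulmx => //; exact: (proj2 hf v).
Qed.

Lemma Ck_C2_on (W : normedModType R) (f : V -> W) : Ck 2 f -> C2_on setT f.
Proof.
by move=> [fd fD] x _; split=> // v; [apply (fD v).1 | move=> w; apply (fD v).2].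
Qed.

End ContinuousDifferentiability.

(** * Schwarz' theorem *)

Section Schwarz.
Variables (R : realType) (V : normedModType R) (U : set V).

Lemma hasD_line (x v : V) (t : R) : hasD (fun a : R => x + a *: v) t 1 v.
Proof.
apply: hasD_eq (hasDD (hasD_cst x t 1) (hasD_scalel v (hasD_id t 1))) _.
by rewrite add0r scale1r.
Qed.

Lemma hasD_along (W : normedModType R) (f : V -> W) (x v : V) (t : R) (d : W) :
  hasD f (x + t *: v) v d -> hasD (fun a : R => f (x + a *: v)) t 1 d.
Proof.
by move=> [f1 fd]; apply: hasD_eq (hasD_comp (hasD_line x v t) f1) _.
Qed.

Lemma MVT_hasD (f df : R -> R) (s : R) : 0 < s ->
  (forall t, 0 <= t <= s -> hasD f t 1 (df t)) ->
  exists2 c, 0 <= c <= s & f s - f 0 = s * df c.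
Proof.
move=> s0 h; have [| |c cs ->] := @MVT _ f df 0 s s0.
- move=> t; rewrite in_itv /= => /andP[/ltW t0 /ltW ts].
  by apply/is_derive_hasD/h; rewrite t0 ts.
- apply: continuous_in_subspaceT => t; rewrite inE /= in_itv /= => ts.
  by apply: differentiable_continuous; have [] := h t ts.
exists c; last by rewrite subr0 mulrC.
by move: cs; rewrite in_itv /= => /andP[/ltW -> /ltW ->].
Qed.

(** The mean value theorem is used twice: along [v] for the increment of [f] in [w], then along [w]
    for [fv]. The left side of the equation is symmetric in [v] and [w], which is what makes it
    useful. *)
Lemma second_difference (f fv fvw : V -> R) (x v w : V) (s : R) : 0 < s ->
  (forall a b, 0 <= a <= s -> 0 <= b <= s -> U (x + a *: v + b *: w)) ->
  (forall y, U y -> hasD f y v (fv y)) ->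
  (forall y, U y -> hasD fv y w (fvw y)) ->
  exists a b, [/\ 0 <= a <= s, 0 <= b <= s &
    f (x + s *: v + s *: w) - f (x + s *: v) - f (x + s *: w) + f x =
    s ^+ 2 * fvw (x + a *: v + b *: w)].
Proof.
move=> s0 hU hv hvw; have s01 : 0 <= s <= s by rewrite lexx ltW.
have s00 : (0 : R) <= 0 <= s by rewrite lexx ltW.
have [a as_ ea] : exists2 a, 0 <= a <= s &
    (f (x + s *: w + s *: v) - f (x + s *: v)) -
    (f (x + s *: w + 0 *: v) - f (x + 0 *: v)) =
    s * (fv (x + s *: w + a *: v) - fv (x + a *: v)).
  apply: (MVT_hasD (f := fun t => f (x + s *: w + t *: v) - f (x + t *: v))
    (df := fun t => fv (x + s *: w + t *: v) - fv (x + t *: v))) => // t ts.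
  apply: hasDB; apply: hasD_along; apply: hv.
    by rewrite addrAC; exact: hU.
  by rewrite -[_ + t *: v]addr0 -(scale0r w); exact: hU.
have [b bs eb] : exists2 b, 0 <= b <= s &
    fv (x + a *: v + s *: w) - fv (x + a *: v + 0 *: w) =
    s * fvw (x + a *: v + b *: w).
  apply: (MVT_hasD (f := fun t => fv (x + a *: v + t *: w))
    (df := fun t => fvw (x + a *: v + t *: w))) => // t ts.
  by apply: hasD_along; apply: hvw; exact: hU.
exists a, b; split => //.
rewrite expr2 -mulrA -eb scale0r addr0 [x + a *: v + s *: w]addrAC -ea.
by rewrite !scale0r !addr0 [x + s *: w + _]addrAC opprB addrA addrAC.
Qed.

(** Exchanging [v] and [w] leaves the second difference unchanged, so the two mixed derivatives
    share a value, taken at two points of a small parallelogram; there each is close to its value at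
    [x]. *)
Lemma schwarz_le (f fv fw fvw fwv : V -> R) (x v w : V) (e : R) : open U -> U x -> 0 < e ->
  (forall y, U y -> hasD f y v (fv y)) ->
  (forall y, U y -> hasD f y w (fw y)) ->
  (forall y, U y -> hasD fv y w (fvw y)) ->
  (forall y, U y -> hasD fw y v (fwv y)) ->
  {for x, continuous fvw} -> {for x, continuous fwv} ->
  `|fvw x - fwv x| <= e.
Proof.
move=> oU Ux e0 hv hw hvw hwv cvw cwv.
have e20 : 0 < e / 2 by rewrite divr_gt0.
have [r /= r0 hr] : exists2 r : R, 0 < r & forall y, `|x - y| < r ->
    [/\ U y, `|fvw x - fvw y| <= e / 2 & `|fwv x - fwv y| <= e / 2].
  have nU : nbhs x U by exact: open_nbhs_nbhs.
  have n1 : \forall y \near x, `|fvw x - fvw y| <= e / 2.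
    by move/cvgrPdist_le : cvw; exact.
  have n2 : \forall y \near x, `|fwv x - fwv y| <= e / 2.
    by move/cvgrPdist_le : cwv; exact.
  have /nbhs_ballP[r /= r0 h] : \forall y \near x,
      [/\ U y, `|fvw x - fvw y| <= e / 2 & `|fwv x - fwv y| <= e / 2].
    by near=> y; split; near: y.
  by exists r => // y xy; apply: h; rewrite -ball_normE.
(* The parallelogram stays within [s * N = r / 2] of [x]; the summand 1 keeps [N] positive when [v]
   and [w] vanish. *)
pose N := `|v| + `|w| + 1; have N0 : 0 < N.
  by rewrite /N ltr_wpDl // addr_ge0.
pose s := r / (2 * N); have s0 : 0 < s by rewrite divr_gt0 // mulr_gt0.
have close a b : 0 <= a <= s -> 0 <= b <= s -> `|x - (x + a *: v + b *: w)| < r.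
  move=> /andP[a0 as_] /andP[b0 bs].
  rewrite -addrA opprD addrA subrr add0r normrN.
  apply: le_lt_trans (ler_normD _ _) _; rewrite !normrZ !ger0_norm //.
  apply: (@le_lt_trans _ _ (s * N)).
    rewrite /N !mulrDr mulr1 -[leLHS]addr0; apply: lerD; last exact: ltW.
    by apply: lerD; exact: ler_wpM2r.
  rewrite /s invfM mulrA -mulrA mulVf ?gt_eqF // mulr1.
  by rewrite ltr_pdivrMr // ltr_pMr // ltr1n.
have [a [b [as_ bs E1]]] := second_difference s0
  (fun a b ha hb => let: And3 h _ _ := hr _ (close a b ha hb) in h) hv hvw.
have close' a' b' : 0 <= a' <= s -> 0 <= b' <= s -> `|x - (x + a' *: w + b' *: v)| < r.
  by move=> ha' hb'; rewrite addrAC; exact: close.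
have [b' [a' [b's a's E2]]] := second_difference s0
  (fun a b ha hb => let: And3 h _ _ := hr _ (close' a b ha hb) in h) hw hwv.
have E : fvw (x + a *: v + b *: w) = fwv (x + b' *: w + a' *: v).
  apply: (@mulfI _ (s ^+ 2)); first by rewrite expf_neq0 // gt_eqF.
  by rewrite -E1 -E2 [x + s *: w + s *: v]addrAC; congr (_ + _); exact: addrAC.
have [_ h1 _] := hr _ (close _ _ as_ bs).
have [_ _ h2] := hr _ (close' _ _ b's a's).
rewrite -(subrKA (fvw (x + a *: v + b *: w))) [e]splitr.
apply: le_trans (ler_normD _ _) _; apply: lerD => //.
by rewrite E distrC.
Unshelve. all: by end_near. Qed.

Lemma schwarz (f fv fw fvw fwv : V -> R) (x v w : V) : open U -> U x ->
  (forall y, U y -> hasD f y v (fv y)) ->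
  (forall y, U y -> hasD f y w (fw y)) ->
  (forall y, U y -> hasD fv y w (fvw y)) ->
  (forall y, U y -> hasD fw y v (fwv y)) ->
  {for x, continuous fvw} -> {for x, continuous fwv} ->
  fvw x = fwv x.
Proof.
move=> oU Ux hv hw hvw hwv cvw cwv; apply/eqP; rewrite -subr_eq0 -normr_le0.
apply/ler_addgt0Pr => e e0; rewrite add0r.
exact: (schwarz_le oU Ux e0 hv hw hvw hwv cvw cwv).
Qed.

End Schwarz.

(** * Skew-symmetric matrices *)

Section SkewMatrices.
Variables (R : realType) (n : nat).
Implicit Types (X Y Z : 'M[R]_n) (x y gam : 'cV[R]_n) (A B : soT R n).

Lemma so_tr A : (vsval A)^T = - vsval A.
Proof. by apply/eqP; rewrite -in_so subvsP. Qed.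

Lemma soP X : X^T = - X -> vsval (vsproj (so R n) X) = X.
Proof. by move=> h; rewrite vsprojK // in_so h. Qed.

Lemma mx11_tr (M : 'M[R]_1) : M^T = M.
Proof. by apply/matrixP => i j; rewrite mxE !ord1. Qed.

Lemma dotE x y : x^T *m y = (dot x y)%:M.
Proof. exact: mx11_scalar. Qed.

Lemma dotC x y : dot x y = dot y x.
Proof. by rewrite /dot -[in LHS](mx11_tr (x^T *m y)) trmx_mul trmxK. Qed.

Lemma dotDl x y z : dot (x + y) z = dot x z + dot y z.
Proof. by rewrite /dot linearD mulmxDl mxE. Qed.

Lemma dotZl (c : R) x y : dot (c *: x) y = c * dot x y.
Proof. by rewrite /dot linearZ -scalemxAl mxE. Qed.

Lemma dotDr x y z : dot z (x + y) = dot z x + dot z y.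
Proof. by rewrite !(dotC z) dotDl. Qed.

Lemma dotZr (c : R) x y : dot x (c *: y) = c * dot x y.
Proof. by rewrite !(dotC x) dotZl. Qed.

Lemma dotNl x y : dot (- x) y = - dot x y.
Proof. by rewrite -scaleN1r dotZl mulN1r. Qed.

Lemma dot_mulmx X x y : dot (X *m x) y = dot x (X^T *m y).
Proof. by rewrite /dot trmx_mul -mulmxA. Qed.

Lemma dotxxE x : dot x x = \sum_i x i 0 ^+ 2.
Proof. by rewrite /dot mxE; apply: eq_bigr => i _; rewrite mxE expr2. Qed.

Lemma dotxx_ge0 x : 0 <= dot x x.
Proof. by rewrite dotxxE; apply: sumr_ge0 => i _; exact: sqr_ge0. Qed.

Lemma dotxx_eq0 x : (dot x x == 0) = (x == 0).
Proof.
apply/eqP/eqP => [|->]; last by rewrite /dot mulmx0 mxE.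
rewrite dotxxE => /eqP; rewrite psumr_eq0 => [/allP h|i _]; last exact: sqr_ge0.
apply/colP => i; rewrite mxE; apply/eqP; rewrite -sqrf_eq0.
by apply: h; rewrite mem_index_enum.
Qed.

Lemma dot_skew X x y : X^T = - X -> dot (X *m x) y = - dot x (X *m y).
Proof. by move=> h; rewrite dot_mulmx h mulNmx dotC dotNl dotC. Qed.

Lemma dot_skew_id X x : X^T = - X -> dot x (X *m x) = 0.
Proof.
move=> h; have := dot_skew x x h; rewrite dotC => /eqP.
by rewrite -addr_eq0 -mulr2n mulrn_eq0 /= => /eqP.
Qed.

Lemma ipC X Y : ip X Y = ip Y X.
Proof. by rewrite /ip mxtrace_mulC. Qed.

Lemma ipDl X Y Z : ip (X + Y) Z = ip X Z + ip Y Z.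
Proof. by rewrite /ip mulmxDl linearD /= mulrDr opprD. Qed.

Lemma ipZl (c : R) X Y : ip (c *: X) Y = c * ip X Y.
Proof. by rewrite /ip -scalemxAl mxtraceZ; ring. Qed.

Lemma ipDr X Y Z : ip Z (X + Y) = ip Z X + ip Z Y.
Proof. by rewrite !(ipC Z) ipDl. Qed.

Lemma ipZr (c : R) X Y : ip X (c *: Y) = c * ip X Y.
Proof. by rewrite !(ipC X) ipZl. Qed.

Lemma ipNl X Y : ip (- X) Y = - ip X Y.
Proof. by rewrite -scaleN1r ipZl mulN1r. Qed.

Lemma ipNr X Y : ip X (- Y) = - ip X Y.
Proof. by rewrite -scaleN1r ipZr mulN1r. Qed.

Lemma ip_comm X Y Z : ip (X *m Y - Y *m X) Z = ip X (Y *m Z - Z *m Y).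
Proof.
rewrite /ip mulmxBl mulmxBr !linearB /= -!mulmxA; congr (- (_ * (_ - _))).
by rewrite mxtrace_mulC -mulmxA.
Qed.

Lemma ip_skew_id X : X^T = - X -> ip X X = 2^-1 * \sum_i \sum_j X i j ^+ 2.
Proof.
move=> h; rewrite /ip -mulrN; congr (_ * _); rewrite -linearN /= -mulmxN -h.
by apply: eq_bigr => i _; rewrite mxE; apply: eq_bigr => j _; rewrite mxE expr2.
Qed.

Lemma ip_skew_ge0 X : X^T = - X -> 0 <= ip X X.
Proof.
move=> h; rewrite ip_skew_id // mulr_ge0 ?invr_ge0 ?ler0n //.
by apply: sumr_ge0 => i _; apply: sumr_ge0 => j _; exact: sqr_ge0.
Qed.

Lemma tensorE x y : tensor x y = x *m y^T. Proof. by []. Qed.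

Lemma tensor_tr x y : (tensor x y)^T = tensor y x.
Proof. by rewrite !tensorE trmx_mul trmxK. Qed.

Lemma tensor_mulmx x y z : tensor x y *m z = dot y z *: x.
Proof. by rewrite tensorE -mulmxA dotE mul_mx_scalar. Qed.

Lemma mulmx_tensor X x y : X *m tensor x y = tensor (X *m x) y.
Proof. by rewrite !tensorE mulmxA. Qed.

Lemma tensor_mulmx_skew X x y : X^T = - X -> tensor x y *m X = - tensor x (X *m y).
Proof. by move=> h; rewrite !tensorE trmx_mul h !mulmxN opprK mulmxA. Qed.

Lemma tr_tensor x y : \tr (tensor x y) = dot y x.
Proof. by rewrite tensorE mxtrace_mulC dotE mxtrace_scalar mulr1n. Qed.

(** By skewness the two traces are opposite, and the 1/2 of the inner product absorbs the resulting
    factor 2. Orthogonality to v_gamma thus becomes a statement about the vector X gamma. *)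
Lemma ip_tensor X x y : X^T = - X -> ip X (wedge x y) = dot x (X *m y).
Proof.
move=> h; rewrite /ip /wedge mulmxBr !mulmx_tensor linearB /= !tr_tensor.
rewrite (dotC y) dot_skew //.
rewrite [X in _ * X](_ : _ = - (2 * dot x (X *m y))); last by ring.
by rewrite mulrN opprK mulrA mulVf ?mul1r // pnatr_eq0.
Qed.

(** Testing with x = A gamma gives the squared norm of A gamma. *)
Lemma h_spaceE gam A : h_space gam A <-> vsval A *m gam = 0.
Proof.
have hA := so_tr A; split=> [h|h x]; last by rewrite ip_tensor // h /dot mulmx0 mxE.
by apply/eqP; rewrite -dotxx_eq0 -ip_tensor // h.
Qed.

Lemma pr_vE gam X : X^T = - X -> pr_v gam X = wedge (X *m gam) gam.
Proof.
by move=> h; rewrite /pr_v mulmx_tensor tensor_mulmx_skew.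
Qed.

Lemma wedge_tr x y : (wedge x y)^T = - wedge x y.
Proof. by rewrite /wedge linearB /= !tensor_tr opprB. Qed.

Lemma wedge_mulmx x gam : dot gam gam = 1 ->
  wedge x gam *m gam = x - dot x gam *: gam.
Proof. by move=> g1; rewrite /wedge mulmxBl !tensor_mulmx g1 scale1r. Qed.

Lemma wedgeBl x y z : wedge (x - y) z = wedge x z - wedge y z.
Proof.
rewrite /wedge !tensorE mulmxBl linearB /= mulmxBr !opprD !opprK.
by rewrite addrACA.
Qed.

Lemma wedgeZl (c : R) x z : wedge (c *: x) z = c *: wedge x z.
Proof. by rewrite /wedge !tensorE -scalemxAl linearZ /= -scalemxAr scalerBr. Qed.

Lemma wedgexx x : wedge x x = 0. Proof. exact: subrr. Qed.

Lemma pr_h_wedge gam x : dot gam gam = 1 -> pr_h gam (wedge x gam) = 0.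
Proof.
move=> g1; rewrite /pr_h pr_vE ?wedge_tr // wedge_mulmx // wedgeBl wedgeZl.
by rewrite wedgexx scaler0 subr0 subrr.
Qed.

Lemma pr_h0E gam X : X^T = - X -> pr_h gam X = 0 -> X = wedge (X *m gam) gam.
Proof. by move=> h; rewrite /pr_h pr_vE // => /subr0_eq. Qed.

Lemma pr_v_tr gam X : X^T = - X -> (pr_v gam X)^T = - pr_v gam X.
Proof. by move=> h; rewrite pr_vE // wedge_tr. Qed.

Lemma pr_h_tr gam X : X^T = - X -> (pr_h gam X)^T = - pr_h gam X.
Proof. by move=> h; rewrite /pr_h linearB /= pr_v_tr // h opprB opprK addrC. Qed.

Lemma pr_h_mulmx gam X : dot gam gam = 1 -> X^T = - X -> pr_h gam X *m gam = 0.
Proof.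
move=> g1 h; rewrite /pr_h pr_vE // mulmxBl wedge_mulmx // dotC dot_skew_id //.
by rewrite scale0r subr0 subrr.
Qed.

Lemma pr_h_pr_v gam X : dot gam gam = 1 -> X^T = - X -> pr_h gam (pr_v gam X) = 0.
Proof. by move=> g1 h; rewrite pr_vE // pr_h_wedge. Qed.

(** Against an element of v_gamma the inner product of so(n) is a scalar product of vectors; through
    this the translational energy of the ball turns into the term with D. *)
Lemma ip_pr_h0 gam X Y : X^T = - X -> Y^T = - Y -> pr_h gam Y = 0 ->
  ip X Y = dot (X *m gam) (Y *m gam).
Proof.
by move=> hX hY /(pr_h0E hY) {1}->; rewrite ip_tensor // dotC.
Qed.

Lemma pr_v_linear gam : linear (@pr_v R n gam).
Proof.
move=> c X Y; rewrite /pr_v mulmxDl mulmxDr -scalemxAl -scalemxAr scalerDr.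
by rewrite addrACA.
Qed.

Lemma pr_h_linear gam : linear (@pr_h R n gam).
Proof.
move=> c X Y; rewrite /pr_h pr_v_linear scalerBr opprD addrACA.
by [].
Qed.

(** X is an infinitesimal rotation in the plane of gamma and X gamma, so its square returns gamma to
    its own line. In the acceleration of the center this is the centripetal part. *)
Lemma sqr_mulmx_pr_h0 gam X : X^T = - X -> pr_h gam X = 0 ->
  X *m (X *m gam) = - dot (X *m gam) (X *m gam) *: gam.
Proof.
move=> h /(pr_h0E h) E; rewrite {1}E /wedge mulmxBl !tensor_mulmx dot_skew_id //.
by rewrite scale0r sub0r scaleNr.
Qed.

(* The derivative of the projector [pr_v] in the direction [gam' = X gam]
   vanishes on [X]. *)
Lemma pr_v_variation gam X : X^T = - X -> pr_h gam X = 0 ->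
  let P := tensor (X *m gam) gam + tensor gam (X *m gam) in
  X *m P + P *m X = 0.
Proof.
move=> h h0 P; rewrite /P mulmxDr mulmxDl !mulmx_tensor !tensor_mulmx_skew //.
rewrite sqr_mulmx_pr_h0 // {P}.
have tZ (c : R) : tensor gam (c *: gam) = tensor (c *: gam) gam.
  by rewrite !tensorE linearZ /= -scalemxAr -scalemxAl.
rewrite tZ [X in _ + X]addrC.
by rewrite addrACA addrN add0r addrN.
Qed.

End SkewMatrices.

(** * Inertia, lambda_0 and the left symmetry *)

Section BallStatics.
Variables (R : realType) (n : nat) (b : rolling_ball R n).
Hypothesis hb : admissible b.
Implicit Types (X Y Z : soT R n) (gam : 'cV[R]_n).

Lemma dist_neq0 : dist b != 0.
Proof.
case: hb => -[s0 r0 _]; rewrite /dist /pm; case: (rolling b) => h _ _.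
- by rewrite mul1r gt_eqF // addr_gt0.
- by rewrite mulN1r gt_eqF // subr_gt0.
- by rewrite mulN1r lt_eqF // subr_lt0.
Qed.

(** The origin of eps: in gamma' the rotating frame contributes - om gamma and the motion of the
    center contributes +/- (rho / dist) om gamma. *)
Lemma pm_rho_dist : 1 - pm b * (rho b / dist b) = eps b.
Proof.
have d0 := dist_neq0; apply: (mulIf d0).
by rewrite /eps divfK // mulrBl mul1r mulrA divfK // /dist addrK.
Qed.

Lemma pm_sqr : pm b ^+ 2 = 1.
Proof. by rewrite /pm; case: (rolling b); rewrite ?expr1n // sqrrN expr1n. Qed.

Lemma total_inertiaE X : total_inertia b X = inertia b X + Dcst b *: X.
Proof. by rewrite /total_inertia add_lfunE scale_lfunE id_lfunE. Qed.

Lemma total_inertia_pos X : ip (vsval (total_inertia b X)) (vsval X) = 0 -> X = 0.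
Proof.
case: hb => -[_ _ m0] _ _ pos.
rewrite total_inertiaE linearD linearZ /= ipDl ipZl.
have [//|X0] := eqVneq X 0; have := pos _ X0.
have := ip_skew_ge0 (so_tr X) => h1 h2 h3.
suff : 0 <= Dcst b * ip (vsval X) (vsval X) by move=> h4; have := ltr_wpDr h4 h2; rewrite h3 ltxx.
by rewrite mulr_ge0 // /Dcst mulr_ge0 ?sqr_ge0 // ltW.
Qed.

Lemma lker_total_inertia : lker (total_inertia b) == 0%VS.
Proof.
apply/lker0P => X Y E; apply/subr0_eq/total_inertia_pos.
by rewrite linearB /= E subrr /ip /= mul0mx mxtrace0 mulr0 oppr0.
Qed.

Lemma total_inertiaK X : omega_of_momentum b (total_inertia b X) = X.
Proof. exact: (lker0_lfunK lker_total_inertia). Qed.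

Lemma omega_of_momentumK X : total_inertia b (omega_of_momentum b X) = X.
Proof. exact: (lker0_lfunVK lker_total_inertia). Qed.

Lemma pr_h_order gam (W : 'M[R]_n) :
  W - tensor gam gam *m W - W *m tensor gam gam = pr_h gam W.
Proof. by rewrite /pr_h /pr_v opprD addrA addrAC. Qed.

Lemma is_lambda0E (m : soT R n) gam lam : is_lambda0 b m gam lam <->
  vsval lam *m gam = 0 /\
  pr_h gam (vsval (omega_of_momentum b (lie m (omega_of_momentum b m) + lam))) = 0.
Proof. by rewrite /is_lambda0 h_spaceE /= pr_h_order. Qed.

(** If Y in v_gamma has I Y in h_gamma, then pairing I Y with Y gives 0, and positivity forces Y =
    0. So [F] is injective, hence onto in finite dimension: so(n) is the direct sum of I v_gamma and
    h_gamma. *)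
Lemma split_momentum gam (M : soT R n) : dot gam gam = 1 ->
  exists Y, pr_h gam (vsval Y) = 0 /\ vsval (total_inertia b Y - M) *m gam = 0.
Proof.
move=> g1; pose pv X : soT R n := vsproj (so R n) (pr_v gam (vsval X)).
pose ph X : soT R n := vsproj (so R n) (pr_h gam (vsval X)).
have pvE X : vsval (pv X) = pr_v gam (vsval X) by rewrite soP // pr_v_tr // so_tr.
have phE X : vsval (ph X) = pr_h gam (vsval X) by rewrite soP // pr_h_tr // so_tr.
pose F X := total_inertia b (pv X) - ph X.
have Flin : linear F.
  move=> c X Y; rewrite /F /pv /ph !linearP pr_v_linear pr_h_linear !linearP.
  by rewrite /= scalerDr addrACA.
pose FL : {linear soT R n -> soT R n} := HB.pack F (GRing.isLinear.Build _ _ _ _ F Flin).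
have kF : lker (linfun FL) == 0%VS.
  apply/lker0P => X Y; rewrite !lfunE => E; apply/subr0_eq.
  have : FL (X - Y) = 0 by rewrite linearB; apply/eqP; rewrite subr_eq0; exact/eqP.
  change (F (X - Y) = 0 -> X - Y = 0).
  move: (X - Y) => {E Y} {}X /subr0_eq E.
  have v0 : pv X = 0.
    apply: total_inertia_pos; rewrite E phE pvE (ip_pr_h0 (gam := gam)).
    - by rewrite pr_h_mulmx ?so_tr // /dot trmx0 mul0mx mxE.
    - by rewrite pr_h_tr ?so_tr.
    - by rewrite pr_v_tr ?so_tr.
    - by rewrite pr_h_pr_v ?so_tr.
  move: E; rewrite v0 linear0 => /esym h0; apply/val_inj => /=.
  rewrite -[LHS](subrK (pr_v gam (vsval X))) -/(pr_h gam (vsval X)) -phE -pvE.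
  by rewrite h0 v0 addr0.
pose X := ((linfun FL)^-1)%VF M; exists (pv X); split.
  by rewrite pvE pr_h_pr_v ?so_tr.
have : FL X = M by rewrite -(lker0_lfunVK kF M) lfunE.
move=> <-; rewrite opprB addrCA subrr addr0 phE.
by rewrite pr_h_mulmx ?so_tr.
Qed.

(** The angular acceleration is taken as the unknown: lambda_0 = I Y - [m, om] with Y in v_gamma.
    Two solutions differ by an acceleration in v_gamma with momentum in h_gamma, which is zero. *)
Lemma lambda0_unique_existence (m : soT R n) gam : dot gam gam = 1 ->
  exists! lam : soT R n, is_lambda0 b m gam lam.
Proof.
move=> g1; set M := lie m (omega_of_momentum b m).
have [Y [Y0 YM]] := split_momentum M g1.
exists (total_inertia b Y - M); split.
  by apply/is_lambda0E; split=> //; rewrite -/M addrC subrK total_inertiaK.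
move=> lam /is_lambda0E[l0]; rewrite -/M => h.
set W := omega_of_momentum b (M + lam) in h.
have IW : total_inertia b W - M = lam by rewrite omega_of_momentumK addrAC subrr add0r.
rewrite -IW; congr (_ - _); congr (total_inertia b _).
apply/subr0_eq/total_inertia_pos; rewrite (ip_pr_h0 (gam := gam)) ?so_tr //.
  rewrite linearB -(subrKA M) (linearD vsval) mulmxDl YM add0r.
  have -> : M - total_inertia b W = - lam by rewrite -IW opprB.
  by rewrite linearN /= mulNmx l0 oppr0 /dot trmx0 mul0mx mxE.
rewrite linearB /= -[_ - _]addrC -scaleN1r pr_h_linear h Y0 scaler0 addr0.
by [].
Qed.

End BallStatics.

(** * The left action of SO(n) *)

Section Symmetry.
Variables (R : realType) (n : nat) (b : rolling_ball R n).
Implicit Types (a g : 'M[R]_n).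

Lemma SO_unit a : SO a -> a \in unitmx.
Proof. by move=> [/mulmx1_unit[]]. Qed.

Lemma SO_inv a : SO a -> invmx a = a^T.
Proof.
move=> ha; have ua := SO_unit ha; case: ha => h _.
by rewrite -[LHS]mul1mx -h mulmxK.
Qed.

Lemma SO_mulT a : SO a -> a *m a^T = 1%:M.
Proof. by move=> ha; rewrite -SO_inv // mulmxV // SO_unit. Qed.

Lemma SO_mul a g : SO a -> SO g -> SO (a *m g).
Proof.
move=> [a1 a2] [g1 g2]; split; last by rewrite det_mulmx a2 g2 mulr1.
by rewrite trmx_mul mulmxA -[_ *m a]mulmxA a1 mulmx1.
Qed.

Lemma SO_tr a : SO a -> SO a^T.
Proof. by move=> ha; case: (ha) => _ d; split; [rewrite trmxK SO_mulT | rewrite det_tr]. Qed.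

Lemma SO_1 : SO (1%:M : 'M[R]_n).
Proof. by split; [rewrite trmx1 mulmx1 | exact: det1]. Qed.

Lemma SO_dot a x y : SO a -> dot (a *m x) (a *m y) = dot x y.
Proof. by case=> h _; rewrite dot_mulmx mulmxA h mul1mx. Qed.

Lemma SO_invM a g : SO a -> SO g -> invmx (a *m g) = invmx g *m invmx a.
Proof.
by move=> ha hg; rewrite !SO_inv ?trmx_mul //; exact: SO_mul.
Qed.

(** In omega and gamma the inverse of g stands on the left, so a cancels; the Lagrangian and the
    constraints depend on the rest only through orthogonal invariants or equivariantly. *)
Lemma left_symmetry a (q v : cfg R n) : SO a -> config b q -> config_tangent q v ->
  [/\ config b (left_act a q) /\
        config_tangent (left_act a q) (left_act a v),
      lagrangian b (left_act a q) (left_act a v) = lagrangian b q v,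
      rubber_distribution b (left_act a q) (left_act a v) <->
        rubber_distribution b q v,
      omega_of (left_act a q) (left_act a v) = omega_of q v &
      gamma_of b (left_act a q) = gamma_of b q].
Proof.
case: q v => [g r] [dg dr] ha [/= hg hr] [/= hdg hdr].
have ua := SO_unit ha.
have E1 : invmx (a *m g) *m (a *m dg) = invmx g *m dg.
  by rewrite SO_invM // -mulmxA mulKmx.
have Eom : omega_of (left_act a (g, r)) (left_act a (dg, dr)) = omega_of (g, r) (dg, dr).
  by rewrite /omega_of /= E1.
have Eg : gamma_of b (left_act a (g, r)) = gamma_of b (g, r).
  by rewrite /gamma_of /= SO_invM // scalemxAr -mulmxA mulKmx.
split=> //.
- split; first by split=> /=; [exact: SO_mul | rewrite SO_dot].
  by split=> /=; [rewrite E1 | rewrite SO_dot].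
- by rewrite /lagrangian Eom /= SO_dot.
split=> -[h1 h2 h3]; split.
- by [].
- move: h2; rewrite Eom /= SO_invM // => h2.
  rewrite -[dr](mulKmx ua) h2 -scalemxAr !mulmxA mulVmx // mul1mx.
  by rewrite -!mulmxA (mulKmx ua).
- by move: h3; rewrite Eom Eg.
- by split=> /=; [rewrite E1 | rewrite SO_dot].
- rewrite Eom /= SO_invM //; move: h2 => /= ->.
  by rewrite -scalemxAr !mulmxA mulmxKV.
- by rewrite Eom Eg.
Qed.

End Symmetry.

(** * The Cayley transform and curves in G *)

Section Cayley.
Variables (R : realType) (n : nat).
Implicit Types (A : 'M[R]_n).

(** If K A = K, then K A K^T is skew while K K^T is symmetric; being equal, both vanish, and the
    diagonal of K K^T holds the squared norms of the rows of K. *)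
Lemma sub1_skew_unit A : A^T = - A -> 1%:M - A \in unitmx.
Proof.
move=> hA; rewrite -row_free_unit -kermx_eq0; set K := kermx _.
have KA : K *m A = K.
  have := mulmx_ker (1%:M - A); rewrite -/K mulmxBr mulmx1 => /subr0_eq <- //.
clearbody K.
have KK : K *m K^T = 0.
  have sk : (K *m A *m K^T)^T = - (K *m A *m K^T).
    by rewrite !trmx_mul trmxK hA mulNmx mulmxN mulmxA.
  move: sk; rewrite KA trmx_mul trmxK => /eqP.
  by rewrite -addr_eq0 -mulr2n -scaler_nat scaler_eq0 pnatr_eq0 /= => /eqP.
apply/eqP/matrixP => i j; move/matrixP/(_ i i): KK; rewrite !mxE => /eqP.
rewrite psumr_eq0 => [/allP /(_ j)|k _]; last by rewrite mxE -expr2 sqr_ge0.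
by rewrite mem_index_enum mxE -expr2 sqrf_eq0 => /(_ isT)/eqP.
Qed.

(** This is (1 - A)^-1 (1 + A), written so that A occurs once and the derivative is that of a single
    inverse. *)
Definition cayley A : 'M[R]_n := 2 *: invmx (1%:M - A) - 1%:M.

(** With P = 1 - A one has P^T = 1 + A, which commutes with P, so P^-1 P^T is orthogonal; its
    determinant is 1 because P and P^T have the same one. *)
Lemma cayley_SO A : A^T = - A -> SO (cayley A).
Proof.
move=> hA; have uP := sub1_skew_unit hA; set P := 1%:M - A in uP.
have PT : P^T = 2%:M - P.
  rewrite /P linearB /= trmx1 hA opprK opprB addrCA -raddfB addrC.
  by congr (_%:M + _); ring.
have cE : cayley A = 2 *: invmx P - 1%:M by [].
clearbody P.
have PPT : P *m P^T = P^T *m P.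
  by rewrite PT mulmxBr mulmxBl mul_mx_scalar mul_scalar_mx.
have CE : cayley A = invmx P *m P^T.
  by rewrite cE PT mulmxBr mulVmx // mul_mx_scalar.
split; last first.
  by rewrite CE det_mulmx det_inv det_tr mulVf // -unitfE -unitmxE.
apply: mulmx1C; rewrite CE trmx_mul trmxK trmx_inv !mulmxA.
by rewrite -[_ *m P^T *m P]mulmxA -PPT !mulmxA mulVmx // mul1mx mulmxV // unitmx_tr.
Qed.

Lemma cayley0 : cayley 0 = 1%:M.
Proof.
rewrite /cayley subr0 invmx1 -[X in _ - X]scale1r -scalerBl.
by rewrite (_ : 2 - 1 = 1 :> R) ?scale1r //; ring.
Qed.

Lemma hasD_cayley (V : normedModType R) (f : V -> 'M[R]_n) x v df :
  (forall y, (f y)^T = - f y) -> hasD f x v df ->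
  hasD (fun y => cayley (f y)) x v
    (2 *: (invmx (1%:M - f x) *m df *m invmx (1%:M - f x))).
Proof.
move=> hf hd.
have h1 : hasD (fun y => 1%:M - f y) x v (0 - df) by apply: hasDB => //; exact: hasD_cst.
apply: hasD_eq (hasDB (hasDZ 2 (hasD_invmx _ h1)) (hasD_cst 1%:M x v)) _.
  by move=> y; exact: sub1_skew_unit.
by rewrite subr0 sub0r mulmxN mulNmx opprK.
Qed.

End Cayley.

Section TangentCurves.
Variables (R : realType) (n : nat) (b : rolling_ball R n).
Hypothesis hb : admissible b.

Lemma hasD_cayley_line (X : soT R n) (c : R) :
  hasD (fun t : R => cayley ((c * t) *: vsval X)) 0 1 ((2 * c) *: vsval X).
Proof.
have h : hasD (fun t : R => (c * t) *: vsval X) 0 1 (c *: vsval X).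
  have h1 := hasDM (hasD_cst (c : R) (0 : R) (1 : R)) (hasD_id (0 : R) 1).
  have h2 := hasD_scalel (vsval X) h1.
  by apply: hasD_eq h2 _; rewrite mul0r add0r mulr1.
apply: hasD_eq (hasD_cayley _ h) _.
  by move=> t; rewrite linearZ /= so_tr scalerN.
by rewrite mulr0 scale0r subr0 invmx1 mul1mx mulmx1 scalerA.
Qed.

Lemma cayley_line_SO (X : soT R n) (c : R) : SO (cayley (c *: vsval X)).
Proof. by apply: cayley_SO; rewrite linearZ /= so_tr scalerN. Qed.

Lemma so_derive_linear (f : R -> 'M[R]_n) (F : 'End(soT R n)) t (df : 'M[R]_n) :
  hasD f t 1 df ->
  so_derive (fun s => F (vsproj (so R n) (f s))) t (F (vsproj (so R n) df)).
Proof.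
move=> hf; apply/is_derive_hasD.
exact: (hasD_linear (@linear_mx_continuous _ _ _ _ (vsval \o F \o vsproj (so R n))) hf).
Qed.

Lemma hasD_pr_v (V : normedModType R) (c : V -> 'cV[R]_n) (X : V -> 'M[R]_n) x v dc dX :
  hasD c x v dc -> hasD X x v dX ->
  hasD (fun y => pr_v (c y) (X y)) x v
    (pr_v (c x) dX + (X x *m (tensor dc (c x) + tensor (c x) dc) +
                      (tensor dc (c x) + tensor (c x) dc) *m X x)).
Proof.
move=> hc hX.
have hT : hasD (fun y => tensor (c y) (c y)) x v (tensor dc (c x) + tensor (c x) dc).
  by apply: hasD_mulmx => //; exact: hasD_trmx.
apply: hasD_eq (hasDD (hasD_mulmx hX hT) (hasD_mulmx hT hX)) _.
by rewrite /pr_v [X in _ + X = _]addrC addrACA.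
Qed.

Lemma pr_v_variationZ (c : R) (gam : 'cV[R]_n) (X : 'M[R]_n) :
  X^T = - X -> pr_h gam X = 0 ->
  let P := tensor (c *: (X *m gam)) gam + tensor gam (c *: (X *m gam)) in
  X *m P + P *m X = 0.
Proof.
move=> hX h0 P.
have -> : P = c *: (tensor (X *m gam) gam + tensor gam (X *m gam)).
  by rewrite /P !tensorE linearZ /= -scalemxAl -scalemxAr scalerDr.
rewrite -scalemxAr -scalemxAl -scalerDr.
by rewrite (pr_v_variation hX h0) scaler0.
Qed.

Lemma field_G_tangent (m : soT R n) (g : 'M[R]_n) (gam : 'cV[R]_n)
    (dm : soT R n) (dg : 'M[R]_n) (dgam : 'cV[R]_n) :
  in_G b m g gam -> field_G b m g gam dm dg dgam ->
  tangent_G b m g gam dm dg dgam.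
Proof.
move=> [hg g1 h0] [lam [/is_lambda0E [l0 hl] dmE -> ->]].
set om := omega_of_momentum b m in h0 dmE *.
rewrite -dmE in hl; set W := omega_of_momentum b dm in hl.
(* Only the velocity at 0 is prescribed, so Cayley transforms can stand in for exponentials; the
   halves compensate their derivative 2 at the origin. Projecting the angular velocity on v_{c(t)}
   keeps the curve in G for every t. *)
pose c t := cayley ((- eps b / 2 * t) *: vsval om) *m gam.
pose h t := g *m cayley ((2^-1 * t) *: vsval om).
pose mu t := total_inertia b (vsproj (so R n) (pr_v (c t) (vsval om + t *: vsval W))).
have c1 t : dot (c t) (c t) = 1 by rewrite SO_dot //; exact: cayley_line_SO.
have c0 : c 0 = gam by rewrite /c mulr0 scale0r cayley0 mul1mx.
have skt t : (vsval om + t *: vsval W)^T = - (vsval om + t *: vsval W).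
  by rewrite linearD linearZ /= !so_tr scalerN opprD.
have hc : hasD c 0 1 (- eps b *: (vsval om *m gam)).
  have h1 := hasD_mulmx (hasD_cayley_line om (- eps b / 2)) (hasD_cst gam (0 : R) (1 : R)).
  apply: hasD_eq h1 _.
  by rewrite mulmx0 addr0 -scalemxAl mulrC divfK // pnatr_eq0.
have hh : hasD h 0 1 (g *m vsval om).
  have h1 := hasD_mulmx (hasD_cst g (0 : R) (1 : R)) (hasD_cayley_line om 2^-1).
  apply: hasD_eq h1 _.
  by rewrite mul0mx add0r mulfV ?scale1r // pnatr_eq0.
have hW : hasD (fun t : R => vsval om + t *: vsval W) 0 1 (vsval W).
  exact: hasD_line.
have omE : pr_v gam (vsval om) = vsval om.
  by rewrite pr_vE ?so_tr // -pr_h0E ?so_tr.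
exists mu, h, c; split.
- move=> t; split; [by apply: SO_mul => //; exact: cayley_line_SO | exact: c1 |].
  by rewrite total_inertiaK // soP ?pr_h_pr_v // pr_v_tr.
- split=> //; last by rewrite /h mulr0 scale0r cayley0 mulmx1.
  rewrite /mu c0 scale0r addr0 omE vsvalK.
  exact: omega_of_momentumK.
- have -> : dm = total_inertia b (vsproj (so R n) (vsval W)).
    by rewrite vsvalK omega_of_momentumK.
  apply: so_derive_linear; apply: hasD_eq (hasD_pr_v hc hW) _.
  (* The moving projector contributes nothing at 0, and [W] already lies in v_gamma by the condition
     on lambda_0. *)
  rewrite c0 scale0r addr0 pr_v_variationZ ?so_tr // addr0.
  by rewrite pr_vE ?so_tr // -pr_h0E ?so_tr.
- exact/is_derive_hasD.
- exact/is_derive_hasD.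
Qed.

End TangentCurves.

(** * Euler-Lagrange equations in a chart *)

Section BilinearDerivatives.
Variables (R : realType) (V : normedModType R) (n : nat).

Lemma hasD_fst (W X : normedModType R) (f : V -> (W * X)%type) x v df :
  hasD f x v df -> hasD (fun y => (f y).1) x v df.1.
Proof. by move=> h; apply: (hasD_linear (g := fst)) h => ?; exact: cvg_fst. Qed.

Lemma hasD_snd (W X : normedModType R) (f : V -> (W * X)%type) x v df :
  hasD f x v df -> hasD (fun y => (f y).2) x v df.2.
Proof. by move=> h; apply: (hasD_linear (g := snd)) h => ?; exact: cvg_snd. Qed.

Lemma hasD_mxlinear (W : normedModType R) m p (g : {linear 'M[R]_(m, p) -> W})
    (f : V -> 'M[R]_(m, p)) x v df :
  hasD f x v df -> hasD (fun y => g (f y)) x v (g df).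
Proof. by move=> h; apply: hasD_linear h; exact: linear_mx_continuous. Qed.

Lemma hasD_dot (f g : V -> 'cV[R]_n) x v df dg :
  hasD f x v df -> hasD g x v dg ->
  hasD (fun y => dot (f y) (g y) : R) x v (dot df (g x) + dot (f x) dg).
Proof.
move=> hf hg; rewrite /dot.
apply: hasD_eq (hasD_coord 0 0 (hasD_mulmx (hasD_trmx hf) hg)) _.
by rewrite mxE.
Qed.

Lemma hasD_ip (f g : V -> 'M[R]_n) x v df dg :
  hasD f x v df -> hasD g x v dg ->
  hasD (fun y => ip (f y) (g y) : R) x v (ip df (g x) + ip (f x) dg).
Proof.
move=> hf hg; rewrite /ip.
have tl : linear (fun M : 'M[R]_n => \tr M : R^o).
  by move=> c A B; rewrite linearP.
pose trl : {linear 'M[R]_n -> R^o} :=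
  HB.pack (fun M : 'M[R]_n => \tr M : R^o) (GRing.isLinear.Build _ _ _ _ _ tl).
have h1 : hasD (fun y => \tr (f y *m g y) : R) x v (\tr (df *m g x + f x *m dg)).
  exact: (hasD_mxlinear trl (hasD_mulmx hf hg)).
apply: hasD_eq (hasDN (hasDZ 2^-1 h1)) _.
by rewrite linearD /= scalerDr opprD.
Qed.

Lemma schwarz_C2_on (U : set V) (phi : V -> cfg R n) x v w : open U -> U x ->
  C2_on U phi -> 'D_w ('D_v phi) x = 'D_v ('D_w phi) x.
Proof.
move=> oU Ux hU.
have h1 u y : U y -> hasD phi y u ('D_u phi y) by move=> /hU[? _ _]; exact: hasDE.
have h2 u u' y : U y -> hasD ('D_u phi) y u' ('D_u' ('D_u phi) y).
  by move=> /hU[_ h _]; exact: hasDE.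
have hc u u' : {for x, continuous ('D_u' ('D_u phi))} by have [_ _] := hU _ Ux.
apply: injective_projections; apply/matrixP => i j.
- apply: (@schwarz _ _ U (fun y => (phi y).1 i j) (fun y => ('D_v phi y).1 i j)
    (fun y => ('D_w phi y).1 i j) (fun y => ('D_w ('D_v phi) y).1 i j)
    (fun y => ('D_v ('D_w phi) y).1 i j) x v w) => //.
  + by move=> y Uy; apply: hasD_coord; apply: hasD_fst; exact: h1.
  + by move=> y Uy; apply: hasD_coord; apply: hasD_fst; exact: h1.
  + by move=> y Uy; apply: hasD_coord; apply: hasD_fst; exact: h2.
  + by move=> y Uy; apply: hasD_coord; apply: hasD_fst; exact: h2.
  + apply: (@continuous_comp _ _ _ _ (fun M : 'M[R]_n => M i j)); last exact: coord_continuous.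
    by apply: (@continuous_comp _ _ _ _ fst); [exact: hc|exact: cvg_fst].
  + apply: (@continuous_comp _ _ _ _ (fun M : 'M[R]_n => M i j)); last exact: coord_continuous.
    by apply: (@continuous_comp _ _ _ _ fst); [exact: hc|exact: cvg_fst].
- apply: (@schwarz _ _ U (fun y => (phi y).2 i j) (fun y => ('D_v phi y).2 i j)
    (fun y => ('D_w phi y).2 i j) (fun y => ('D_w ('D_v phi) y).2 i j)
    (fun y => ('D_v ('D_w phi) y).2 i j) x v w) => //.
  + by move=> y Uy; apply: hasD_coord; apply: hasD_snd; exact: h1.
  + by move=> y Uy; apply: hasD_coord; apply: hasD_snd; exact: h1.
  + by move=> y Uy; apply: hasD_coord; apply: hasD_snd; exact: h2.
  + by move=> y Uy; apply: hasD_coord; apply: hasD_snd; exact: h2.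
  + apply: (@continuous_comp _ _ _ _ (fun M : 'cV[R]_n => M i j)); last exact: coord_continuous.
    by apply: (@continuous_comp _ _ _ _ snd); [exact: hc|exact: cvg_snd].
  + apply: (@continuous_comp _ _ _ _ (fun M : 'cV[R]_n => M i j)); last exact: coord_continuous.
    by apply: (@continuous_comp _ _ _ _ snd); [exact: hc|exact: cvg_snd].
Qed.

End BilinearDerivatives.

Section EulerLagrange.
Variables (R : realType) (n : nat) (b : rolling_ball R n).
Hypothesis hb : admissible b.
Variables (N : nat) (U : set 'rV[R]_N) (phi : 'rV[R]_N -> cfg R n).
Hypothesis hphi : local_parametrization b U phi.

(* Retracting both arguments to so(n) makes [kinetic] symmetric on all matrices. *)
Definition kinetic (X Y : 'M[R]_n) : R :=
  ip (vsval (inertia b (vsproj (so R n) X))) (vsval (vsproj (so R n) Y)).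

Lemma kineticC X Y : kinetic X Y = kinetic Y X.
Proof. by case: hb => _ _ h _; rewrite /kinetic h ipC. Qed.

Lemma kineticB X Y Z : kinetic X (Y - Z) = kinetic X Y - kinetic X Z.
Proof. by rewrite /kinetic !linearB /= ipDr ipNr. Qed.

Lemma hasD_kinetic (V : normedModType R) (f g : V -> 'M[R]_n) x v df dg :
  hasD f x v df -> hasD g x v dg ->
  hasD (fun y => kinetic (f y) (g y) : R) x v (kinetic df (g x) + kinetic (f x) dg).
Proof.
move=> hf hg; apply: hasD_ip.
  exact: (hasD_mxlinear (vsval \o inertia b \o vsproj (so R n)) hf).
exact: (hasD_mxlinear (vsval \o vsproj (so R n)) hg).
Qed.

Lemma hasD_lagrangian (V : normedModType R) (f : V -> 'M[R]_n) (h : V -> 'cV[R]_n)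
    x v df dh :
  hasD f x v df -> hasD h x v dh ->
  hasD (fun y => 2^-1 * kinetic (f y) (f y) + 2^-1 * mass b * dot (h y) (h y) : R)
    x v (kinetic (f x) df + mass b * dot (h x) dh).
Proof.
move=> hf hh.
have h1 := hasDZ 2^-1 (hasD_kinetic hf hf).
have h2 := hasDZ (2^-1 * mass b) (hasD_dot hh hh).
apply: hasD_eq (hasDD h1 h2) _.
rewrite (kineticC df) (dotC dh).
have e2 (c : R) : 2^-1 * (c + c) = c by rewrite -mulr2n -[c *+ 2]mulr_natl mulKf // pnatr_eq0.
rewrite /GRing.scale /= e2; congr (_ + _).
by rewrite mulrAC e2 mulrC.
Qed.

(** The transpose agrees with the inverse on SO(n), and being linear it allows the product rule. *)
Let T1 y v : 'M[R]_n := (phi y).1^T *m ('D_v phi y).1.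
Let T2 y v : 'cV[R]_n := ('D_v phi y).2.

Lemma chart_SO y : U y -> SO (phi y).1.
Proof. by case: hphi => _ h _ _ _ /h[]. Qed.

Lemma chart_hasD y v : U y -> hasD phi y v ('D_v phi y).
Proof. by case: hphi => -[_ hU] _ _ _ _ /hU[? _ _]; exact: hasDE. Qed.

Lemma chart_hasD2 y v w : U y -> hasD ('D_v phi) y w ('D_w ('D_v phi) y).
Proof. by case: hphi => -[_ hU] _ _ _ _ /hU[_ h _]; exact: hasDE. Qed.

Lemma chart_skew y v : U y -> (T1 y v)^T = - T1 y v.
Proof.
move=> Uy; case: hphi => _ _ _ _ /(_ y Uy) E.
have [+ _] : config_tangent (phi y) ('D_v phi y) by rewrite E; exists v.
by rewrite SO_inv ?in_so; [move/eqP|exact: chart_SO].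
Qed.

Lemma local_lagrangianE y v : U y -> local_lagrangian b phi y v =
  2^-1 * kinetic (T1 y v) (T1 y v) + 2^-1 * mass b * dot (T2 y v) (T2 y v).
Proof.
move=> Uy; rewrite /local_lagrangian /lagrangian /omega_of /kinetic.
by rewrite SO_inv //; exact: chart_SO.
Qed.

(** The velocity enters the local Lagrangian only through this linear map, which makes the partial
    derivatives in the velocity explicit. *)
Lemma chart_linear y : U y -> forall v w, hasD (fun u => 'D_u phi y) v w ('D_w phi y).
Proof.
move=> Uy v w; have [d _] := chart_hasD 0 Uy.
have -> : (fun u => 'D_u phi y) = 'd phi y by apply/funext => u; rewrite deriveE.
rewrite deriveE //; apply: hasD_linear (hasD_id v w).
exact: linear_mx_continuous.
Qed.

(** The commutator arises because the factor g^T in the angular velocity is differentiated along the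
    motion in one half of the covector and along the coordinate direction in the other. *)
Lemma euler_lagrange_chart (x : R -> 'rV[R]_N) (q : R -> cfg R n) (t : R)
    (dom : 'M[R]_n) (acc : 'cV[R]_n) (i : 'I_N) :
  (\forall s \near t, [/\ U (x s), phi (x s) = q s & twice_derivable x s]) ->
  hasD (fun s => (q s).1^T *m (derive1 q s).1) t 1 dom ->
  hasD (fun s => (derive1 q s).2) t 1 acc ->
  let Om := (q t).1^T *m (derive1 q t).1 in
  let IOm := vsval (inertia b (vsproj (so R n) Om)) in
  let e := 'D_(delta_mx 0 i) phi (x t) in
  euler_lagrange (local_lagrangian b phi) x t i =
  ip (vsval (inertia b (vsproj (so R n) dom)) - (IOm *m Om - Om *m IOm))
     ((q t).1^T *m e.1) + mass b * dot acc e.2.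
Proof.
move=> hx hdom hacc Om IOm e.
case: (hphi) => -[oU hC] _ _ _ _.
have [Ut qt [xt _]] := nbhs_singleton hx.
(* Needed on a neighbourhood, because the momentum is differentiated once more in time. *)
have qD : \forall s \near t, derive1 q s = 'D_(derive1 x s) phi (x s).
  have hx2 := near_join hx.
  near=> s.
  have [Us qs [xs _]] : [/\ U (x s), phi (x s) = q s & twice_derivable x s] by near: s.
  apply: derive1_hasD; apply: (hasD_near (f := fun s => phi (x s))).
    have : \near s, [/\ U (x s), phi (x s) = q s & twice_derivable x s] by near: s.
    by apply: filterS => u [].
  apply: hasD_comp (hasD_derive1 xs) _.
  by have [] := chart_hasD 0 Us.
have qDt := nbhs_singleton qD.
set ei : 'rV[R]_N := delta_mx 0 i.
have vD (y v w : 'rV[R]_N) : U y ->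
    'D_w (local_lagrangian b phi y) v =
    kinetic (T1 y v) (T1 y w) + mass b * dot (T2 y v) (T2 y w).
  move=> Uy.
  have -> : local_lagrangian b phi y = fun v => 2^-1 * kinetic (T1 y v) (T1 y v) +
      2^-1 * mass b * dot (T2 y v) (T2 y v).
    by apply/funext => u; exact: local_lagrangianE.
  have hL := chart_linear Uy v w.
  have hc := hasD_cst (phi y).1^T v w.
  have h1 : hasD (T1 y) v w (T1 y w).
    by apply: hasD_eq (hasD_mulmx hc (hasD_fst hL)) _; rewrite mul0mx add0r.
  by have [_ ->] := hasD_lagrangian h1 (hasD_snd hL).
(* A common name for the two mixed derivatives of the chart, so that they cancel between the two
   halves of the covector. *)
have [S2 [Sv Sw]] : exists S, 'D_(derive1 x t) ('D_ei phi) (x t) = S /\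
    'D_ei ('D_(derive1 x t) phi) (x t) = S.
  by eexists; split; [exact: (schwarz_C2_on ei (derive1 x t) oU Ut hC) | ].
have D1 : hasD (fun s => 'D_ei (local_lagrangian b phi (x s)) (derive1 x s) : R) t 1
   (kinetic dom (T1 (x t) ei) +
    kinetic Om ((derive1 q t).1^T *m e.1 +
       (phi (x t)).1^T *m S2.1) +
    mass b * (dot acc e.2 + dot (derive1 q t).2 S2.2)).
  apply: (hasD_near (f := fun s => kinetic ((q s).1^T *m (derive1 q s).1) (T1 (x s) ei) +
     mass b * dot (derive1 q s).2 (T2 (x s) ei))).
    near=> s.
    have [Us qs _] : [/\ U (x s), phi (x s) = q s & twice_derivable x s] by near: s.
    have qDs : derive1 q s = 'D_(derive1 x s) phi (x s) by near: s.
    by rewrite (vD _ _ _ Us) /T1 /T2 -qDs qs.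
  have hxt := hasD_derive1 xt.
  have d0 : hasD (fun s => phi (x s)) t 1 (derive1 q t).
    by rewrite qDt; apply: hasD_comp hxt _; have [] := chart_hasD 0 Ut.
  have h0 : differentiable ('D_ei phi) (x t) by have [] := chart_hasD2 ei 0 Ut.
  have d1 := hasD_eq (hasD_comp (g := 'D_ei phi) hxt h0) Sv.
  have d2 := hasD_mulmx (hasD_trmx (hasD_fst d0)) (hasD_fst d1).
  have d3 := hasD_kinetic hdom d2.
  have d4 := hasDZ (mass b) (hasD_dot hacc (hasD_snd d1)).
  exact: hasDD d3 d4.
have D2 : 'D_ei (fun y => local_lagrangian b phi y (derive1 x t)) (x t) =
   kinetic Om (e.1^T *m (derive1 q t).1 +
       (phi (x t)).1^T *m S2.1) +
    mass b * dot (derive1 q t).2 S2.2.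
  have UU : \forall y \near x t, U y by exact: open_nbhs_nbhs.
  rewrite (near_eq_derive (g := fun y => 2^-1 * kinetic (T1 y (derive1 x t)) (T1 y (derive1 x t)) +
      2^-1 * mass b * dot (T2 y (derive1 x t)) (T2 y (derive1 x t)))); last first.
    by apply: filterS UU => y Uy; exact: local_lagrangianE.
  have d0 := chart_hasD ei Ut.
  have d1 := hasD_eq (chart_hasD2 (derive1 x t) ei Ut) Sw.
  have d2 := hasD_mulmx (hasD_trmx (hasD_fst d0)) (hasD_fst d1).
  by have [_ ->] := hasD_lagrangian d2 (hasD_snd d1); rewrite /T1 /T2 -qDt qt.
have [_ D1'] := D1.
apply: etrans (congr2 (fun u v : R => u - v) D1' D2) _.
clear D1 D1' D2 Sv Sw; set S1 := (phi (x t)).1^T *m S2.1.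
have gSO : SO (q t).1 by rewrite -qt; exact: chart_SO.
have TE : T1 (x t) ei = (q t).1^T *m e.1 by rewrite /T1 qt.
have eE : (q t).1 *m T1 (x t) ei = e.1.
  by rewrite TE mulmxA (SO_mulT gSO) mul1mx.
have OE : (q t).1 *m Om = (derive1 q t).1.
  by rewrite /Om mulmxA (SO_mulT gSO) mul1mx.
have OmT : Om^T = - Om.
  have := chart_skew (derive1 x t) Ut; rewrite /T1 -qDt qt; exact.
have eT := chart_skew ei Ut.
have gg : (q t).1^T *m (q t).1 = 1%:M by case: gSO.
move: (T1 (x t) ei) eT eE TE => W eT eE TE; rewrite -TE.
clearbody Om e.
rewrite -eE -OE !trmx_mul OmT eT -!mulmxA !(mulmxA _^T) gg !mul1mx !mulNmx.
(* What remains is the pairing of I Om with [Om, W]; invariance of the trace form moves the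
   commutator onto I Om. *)
have kE : kinetic Om (- (Om *m W) + S1) - kinetic Om (- (W *m Om) + S1) =
    - ip (IOm *m Om - Om *m IOm) W.
  rewrite -kineticB opprD addrACA subrr addr0 opprK.
  rewrite /kinetic soP; last first.
    by rewrite linearD linearN /= !trmx_mul OmT eT !mulNmx !mulmxN !opprK opprD opprK addrC.
  by rewrite addrC -opprB ipNr ip_comm.
have kW : kinetic dom W = ip (vsval (inertia b (vsproj (so R n) dom))) W.
  by rewrite /kinetic soP.
rewrite ipDl ipNl -kE -kW.
rewrite mulrDr.
ring.
Unshelve. all: by end_near. Qed.

End EulerLagrange.

(** * The d'Alembert principle on the distribution *)

Section Kinematics.
Variables (R : realType) (n : nat) (b : rolling_ball R n).
Hypothesis hb : admissible b.

Lemma gamma_ofE (q : cfg R n) : SO q.1 ->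
  gamma_of b q = (dist b)^-1 *: (q.1^T *m q.2).
Proof. by move=> h; rewrite /gamma_of SO_inv // -scalemxAr. Qed.

Lemma gamma_ofK (q : cfg R n) : SO q.1 -> q.2 = dist b *: (q.1 *m gamma_of b q).
Proof.
move=> h; rewrite gamma_ofE // -scalemxAr scalerA mulfV ?scale1r ?dist_neq0 //.
by rewrite mulmxA SO_mulT // mul1mx.
Qed.

Lemma gamma_of_unit (q : cfg R n) : config b q -> dot (gamma_of b q) (gamma_of b q) = 1.
Proof.
move=> [h hd]; have d0 := dist_neq0 hb.
have := hd; rewrite (gamma_ofK h) dotZl dotZr SO_dot // mulrA -expr2.
by move=> /(canRL (mulKf _)) ->; rewrite ?mulVf // expf_neq0.
Qed.

Lemma rubber_kinematics (q v : cfg R n) : config b q -> rubber_distribution b q v ->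
  let Om := q.1^T *m v.1 in let gam := gamma_of b q in
  [/\ vsval (omega_of q v) = Om, Om^T = - Om, v.1 = q.1 *m Om,
      v.2 = (pm b * rho b) *: (q.1 *m (Om *m gam)) & pr_h gam Om = 0].
Proof.
move=> [hq hd] [[hv _] hv2 hp] Om gam; have d0 := dist_neq0 hb.
have E : vsval (omega_of q v) = Om by rewrite vsprojK // SO_inv.
have OT : Om^T = - Om by move: hv; rewrite in_so SO_inv // => /eqP.
have vE : v.1 = q.1 *m Om by rewrite mulmxA SO_mulT // mul1mx.
split => //; last by rewrite -E.
clearbody Om.
rewrite hv2 E SO_inv // {1}(gamma_ofK hq) -scalemxAr scalerA.
rewrite -!mulmxA (mulmxA q.1^T) hq.1 mul1mx.
by congr (_ *: _); rewrite mulrA divfK.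
Qed.

Lemma rubber_distributionI (q : cfg R n) (Om : 'M[R]_n) : config b q ->
  Om^T = - Om -> pr_h (gamma_of b q) Om = 0 ->
  rubber_distribution b q
    (q.1 *m Om, (pm b * rho b) *: (q.1 *m (Om *m gamma_of b q))).
Proof.
move=> hc hO h0; case: (hc) => hq hd; have d0 := dist_neq0 hb.
have E0 : invmx q.1 *m (q.1 *m Om) = Om by rewrite mulKmx // SO_unit.
have E : vsval (omega_of q (q.1 *m Om, (pm b * rho b) *: (q.1 *m (Om *m gamma_of b q)))) = Om.
  by rewrite /omega_of /= E0 soP.
split; last by rewrite E.
- split; rewrite /= ?E0 ?in_so ?hO //.
  rewrite {1}(gamma_ofK hq) dotZl dotZr SO_dot // dot_skew_id //.
  by rewrite !mulr0.
- rewrite E /= SO_inv // [in RHS](gamma_ofK hq) -scalemxAr scalerA.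
  rewrite -!mulmxA (mulmxA q.1^T) hq.1 mul1mx.
  by congr (_ *: _); rewrite mulrA divfK.
Qed.

Variables (q : R -> cfg R n) (t : R).
Hypothesis hK : \forall s \near t, [/\ config b (q s), derivable q s 1 &
  rubber_distribution b (q s) (derive1 q s)].

Let Om s := (q s).1^T *m (derive1 q s).1.
Let gam s := gamma_of b (q s).

Lemma hasD_gamma : hasD gam t 1 (- eps b *: (Om t *m gam t)).
Proof.
have [hc hq hr] := nbhs_singleton hK; have d0 := dist_neq0 hb.
have [_ OT v1 v2 _] := rubber_kinematics hc hr.
have hqD := hasD_derive1 hq.
apply: (hasD_near (f := fun s => (dist b)^-1 *: ((q s).1^T *m (q s).2))).
  by apply: filterS hK => s [[h _] _ _]; rewrite /gam gamma_ofE.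
apply: hasD_eq (hasDZ _ (hasD_mulmx (hasD_trmx (hasD_fst hqD)) (hasD_snd hqD))) _.
rewrite v2 v1 -/(Om t) -/(gam t) trmx_mul OT (gamma_ofK hc.1) -/(gam t).
rewrite -!scalemxAr -[_ *m (_)^T *m _]mulmxA !(mulmxA (q t).1^T) hc.1.1 !mul1mx.
rewrite mulNmx scalerDr !scalerA mulVf // scale1r -(pm_rho_dist hb) opprB scalerBl scale1r.
by rewrite addrC; congr (_ *: _ - _); rewrite mulrC mulrA.
Qed.

Variable dom : 'M[R]_n.
Hypothesis hdom : hasD Om t 1 dom.

Lemma dom_skew : dom^T = - dom.
Proof.
have h : hasD (fun s => - (Om s)^T) t 1 dom.
  apply: hasD_near hdom; apply: filterS hK => s [hc _ hr].
  by have [_ -> _ _ _] := rubber_kinematics hc hr; rewrite opprK.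
have E : - dom^T = dom := etrans (esym (hasDN (hasD_trmx hdom)).2) h.2.
by rewrite -[in RHS]E opprK.
Qed.

Lemma dom_pr_h : pr_h (gam t) dom = 0.
Proof.
have [hc hq hr] := nbhs_singleton hK.
have [_ OT v1 v2 h0] := rubber_kinematics hc hr.
have h : hasD (fun s => pr_v (gam s) (Om s)) t 1 dom.
  apply: hasD_near hdom; apply: filterS hK => s [hcs _ hrs].
  by have [_ _ _ _] := rubber_kinematics hcs hrs; move/subr0_eq.
have := hasD_pr_v hasD_gamma hdom; rewrite pr_v_variationZ // addr0 => -[_ E].
by have [_] := h; rewrite E /pr_h => ->; rewrite subrr.
Qed.

Lemma hasD_velocity : hasD (fun s => (derive1 q s).2) t 1
  ((pm b * rho b) *: ((q t).1 *m
    ((1 - eps b) *: (Om t *m (Om t *m gam t)) + dom *m gam t))).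
Proof.
have [hc hq hr] := nbhs_singleton hK.
have [_ OT v1 v2 _] := rubber_kinematics hc hr.
apply: (hasD_near (f := fun s => (pm b * rho b) *: ((q s).1 *m (Om s *m gam s)))).
  by apply: filterS hK => s [hcs _ hrs]; have [_ _ _ -> _] := rubber_kinematics hcs hrs.
have hqD := hasD_derive1 hq.
have h2 := hasDZ (pm b * rho b) (hasD_mulmx (hasD_fst hqD) (hasD_mulmx hdom hasD_gamma)).
apply: hasD_eq h2 _; congr (_ *: _).
rewrite v1 -/(Om t) -mulmxA -mulmxDr; congr (_ *m _).
by rewrite scalerBl scale1r -scalemxAr scaleNr addrCA addrC.
Qed.

(** Stated for any chart and any curve satisfying the constraints, so that it serves both directions
    of the equivalence. *)
Lemma virtual_work (N : nat) (U : set 'rV[R]_N) (phi : 'rV[R]_N -> cfg R n)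
    (x : R -> 'rV[R]_N) (w : 'rV[R]_N) :
  local_parametrization b U phi ->
  (\forall s \near t, [/\ U (x s), phi (x s) = q s & twice_derivable x s]) ->
  rubber_distribution b (q t) ('D_w phi (x t)) ->
  let m := total_inertia b (vsproj (so R n) (Om t)) in
  \sum_(i < N) euler_lagrange (local_lagrangian b phi) x t i * w 0 i =
  ip (vsval (total_inertia b (vsproj (so R n) dom) - lie m (vsproj (so R n) (Om t))))
     ((q t).1^T *m ('D_w phi (x t)).1).
Proof.
move=> hphi hx hw m.
have [hc hq hr] := nbhs_singleton hK.
have [_ OT v1 v2 h0] := rubber_kinematics hc hr.
have [_ WT w1 w2 w0] := rubber_kinematics hc hw.
have [Ut qt _] := nbhs_singleton hx.
set e := fun i : 'I_N => 'D_(delta_mx 0 i) phi (x t).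
have eE : 'D_w phi (x t) = \sum_i w 0 i *: e i.
  have [d _] := chart_hasD hphi 0 Ut.
  rewrite /e deriveE // [in LHS](row_sum_delta w) linear_sum; apply: eq_bigr => i _.
  by rewrite linearZ /= -deriveE.
set IOm := vsval (inertia b (vsproj (so R n) (Om t))).
have hacc := hasD_velocity; set acc := (pm b * rho b) *: _ in hacc.
set F := vsval (inertia b (vsproj (so R n) dom)) - (IOm *m Om t - Om t *m IOm).
have -> : \sum_(i < N) euler_lagrange (local_lagrangian b phi) x t i * w 0 i =
    \sum_i (ip F ((q t).1^T *m (e i).1) + mass b * dot acc (e i).2) * w 0 i.
  apply: eq_bigr => i _; congr (_ * _).
  exact: (euler_lagrange_chart hb hphi i hx hdom hacc).
have -> : \sum_i (ip F ((q t).1^T *m (e i).1) + mass b * dot acc (e i).2) * w 0 i =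
    ip F ((q t).1^T *m ('D_w phi (x t)).1) + mass b * dot acc ('D_w phi (x t)).2.
  rewrite eE; apply: (big_rec2 (fun (u : R) (v : cfg R n) =>
    u = ip F ((q t).1^T *m v.1) + mass b * dot acc v.2)) => [|i y1 y2 _ ->].
    by rewrite /= mulmx0 /ip /dot !mulmx0 mxtrace0 mxE !mulr0 oppr0 addr0.
  rewrite /= !mulmxDr -!scalemxAr !ipDr !dotDr ipZr dotZr; ring.
move: ('D_w phi (x t)) WT w1 w2 w0 => v; set W := (q t).1^T *m v.1 => WT w1 w2 w0.
(* The centripetal part of the acceleration is along g gamma, whereas the virtual displacement is
   along g W gamma, orthogonal to it; the sign +/- is squared away. *)
have -> : dot acc v.2 = rho b ^+ 2 * ip dom W.
  rewrite (ip_pr_h0 dom_skew WT w0) /acc w2 dotZl dotZr SO_dot; last exact: hc.1.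
  rewrite dotDl dotZl (sqr_mulmx_pr_h0 OT h0) dotZl dot_skew_id //.
  rewrite !mulr0 add0r mulrA; congr (_ * _).
  by rewrite mulrACA -!expr2 pm_sqr mul1r.
have OE : vsval (vsproj (so R n) (Om t)) = Om t by exact: soP.
have dE : vsval (vsproj (so R n) dom) = dom by apply: soP; exact: dom_skew.
have mE : vsval m = IOm + Dcst b *: Om t.
  by rewrite /m total_inertiaE linearD linearZ /= OE.
(* Adding D Om to the momentum does not change its commutator with Om. *)
have cE : vsval m *m Om t - Om t *m vsval m = IOm *m Om t - Om t *m IOm.
  rewrite mE mulmxDl mulmxDr -scalemxAl -scalemxAr opprD addrACA.
  by rewrite [X in _ + X]subrr addr0.
rewrite linearB /= OE cE total_inertiaE linearD linearZ /= dE.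
by rewrite [in RHS]addrAC [RHS]ipDl -/F [in RHS]ipZl /Dcst mulrA.
Qed.

End Kinematics.

(** * Charts of the configuration manifold *)

Import VectorInternalTheory.

Lemma mx11_unit (R : realType) (M : 'M[R]_1) : (M \in unitmx) = (M 0 0 != 0).
Proof. by rewrite unitmxE det_mx11 unitfE. Qed.

(** * Inversion in the unit sphere *)

Section Inversion.
Variables (R : realType) (n : nat).
Implicit Types (p u v z : 'cV[R]_n).

(** This is z / |z|^2, with the scalar as a 1 x 1 matrix, so that the results on [invmx] give its
    regularity. *)
Definition inversion z : 'cV[R]_n := z *m invmx (z^T *m z).

Lemma inversionE z : inversion z = (dot z z)^-1 *: z.
Proof. by rewrite /inversion dotE invmx_scalar mul_mx_scalar. Qed.

Lemma inversionZ (c : R) z : inversion (c *: z) = c^-1 *: inversion z.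
Proof.
have [->|c0] := eqVneq c 0; first by rewrite invr0 !scale0r /inversion mul0mx.
rewrite !inversionE dotZl dotZr !scalerA; congr (_ *: _).
by rewrite invfM mulrAC mulVf // mul1r invfM.
Qed.

Lemma inversionK z : inversion (inversion z) = z.
Proof.
have [->|z0] := eqVneq z 0; first by rewrite /inversion !mul0mx.
rewrite [inversion z]inversionE inversionZ inversionE scalerA invrK mulfV ?scale1r //.
by rewrite dotxx_eq0.
Qed.

(** Reflection in the hyperplane orthogonal to p; divided by |p|^2 it is the derivative of the
    inversion at p. *)
Definition reflection p v : 'cV[R]_n := v - (2 * ((dot p p)^-1 * dot p v)) *: p.

Lemma reflectionZ p (c : R) v : reflection p (c *: v) = c *: reflection p v.
Proof. by rewrite /reflection dotZr scalerBr scalerA; congr (_ - _ *: _); ring. Qed.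

Lemma reflection_dot p u v : dot (reflection p u) v = dot u (reflection p v).
Proof.
rewrite /reflection -!(scaleNr _ p) dotDl dotDr dotZl dotZr (dotC u p); congr (_ + _).
by ring.
Qed.

Lemma reflectionK p v : p != 0 -> reflection p (reflection p v) = v.
Proof.
move=> p0; have d0 : dot p p != 0 by rewrite dotxx_eq0.
have E : dot p (reflection p v) = - dot p v.
  rewrite /reflection -(scaleNr _ p) dotDr dotZr; field; exact: d0.
rewrite {1}/reflection E /reflection -addrA -opprD -scalerDl.
by rewrite [X in X *: p](_ : _ = 0) ?scale0r ?subr0 //; ring.
Qed.

Lemma hasD_inversion (V : normedModType R) (f : V -> 'cV[R]_n) (x v : V) df :
  (forall y, f y != 0) -> hasD f x v df ->
  hasD (fun y => inversion (f y)) x v ((dot (f x) (f x))^-1 *: reflection (f x) df).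
Proof.
move=> f0 hf.
have hu y : (f y)^T *m f y \in unitmx by rewrite mx11_unit -/(dot _ _) dotxx_eq0.
have h := hasD_mulmx hf (hasD_invmx hu (hasD_mulmx (hasD_trmx hf) hf)).
apply: hasD_eq h _.
have d0 : dot (f x) (f x) != 0 by rewrite dotxx_eq0.
rewrite !dotE invmx_scalar mul_mx_scalar -raddfD /= -!scalar_mxM -raddfN mul_mx_scalar.
rewrite /reflection scalerBr scalerA -(scaleNr _ (f x)); congr (_ + _ *: _).
by rewrite (dotC df); ring.
Qed.

End Inversion.

(** * Curves twice derivable near an instant *)

Section RegularCurves.
Variables (R : realType) (t : R).

Definition regular (W : normedModType R) (f : R -> W) : Prop :=
  \forall s \near t, twice_derivable f s.

Lemma regularP (W : normedModType R) (f : R -> W) :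
  regular f <-> exists f' f'' : R -> W,
    \forall s \near t, hasD f s 1 (f' s) /\ hasD f' s 1 (f'' s).
Proof.
split=> [h|[f' [f'' h]]].
  exists (derive1 f), (derive1 (derive1 f)).
  by apply: filterS h => s [h1 h2]; split; exact: hasD_derive1.
have := near_join h; apply: filterS => s hs.
have [h1 h2] := nbhs_singleton hs; split.
  by have [d _] := h1; exact: diff_derivable.
have h3 : hasD (derive1 f) s 1 (f'' s).
  apply: hasD_near h2; apply: filterS hs => u [hu _].
  by rewrite (derive1_hasD hu).
by have [d _] := h3; exact: diff_derivable.
Qed.

Lemma regular_cst (W : normedModType R) (c : W) : regular (fun=> c).
Proof.
by apply/regularP; exists (fun=> 0), (fun=> 0); near=> s; split; exact: hasD_cst.
Unshelve. all: by end_near. Qed.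

Lemma regularD (W : normedModType R) (f g : R -> W) :
  regular f -> regular g -> regular (fun s => f s + g s).
Proof.
move=> /regularP[f1 [f2 hf]] /regularP[g1 [g2 hg]]; apply/regularP.
exists (fun s => f1 s + g1 s), (fun s => f2 s + g2 s).
by apply: filterS2 hf hg => s [? ?] [? ?]; split; exact: hasDD.
Qed.

Lemma regular_pair (W X : normedModType R) (f : R -> W) (g : R -> X) :
  regular f -> regular g -> regular (fun s => (f s, g s)).
Proof.
move=> /regularP[f1 [f2 hf]] /regularP[g1 [g2 hg]]; apply/regularP.
exists (fun s => (f1 s, g1 s)), (fun s => (f2 s, g2 s)).
by apply: filterS2 hf hg => s [? ?] [? ?]; split; exact: hasD_pair.
Qed.

Lemma regular_linear (W X : normedModType R) (g : {linear W -> X}) (f : R -> W) :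
  continuous g -> regular f -> regular (fun s => g (f s)).
Proof.
move=> gc /regularP[f1 [f2 hf]]; apply/regularP.
exists (fun s => g (f1 s)), (fun s => g (f2 s)).
by apply: filterS hf => s [? ?]; split; exact: hasD_linear.
Qed.

Lemma regular_mulmx m n p (f : R -> 'M[R]_(m, n)) (g : R -> 'M[R]_(n, p)) :
  regular f -> regular g -> regular (fun s => f s *m g s).
Proof.
move=> /regularP[f1 [f2 hf]] /regularP[g1 [g2 hg]]; apply/regularP.
exists (fun s => f1 s *m g s + f s *m g1 s),
  (fun s => f2 s *m g s + f1 s *m g1 s + (f1 s *m g1 s + f s *m g2 s)).
apply: filterS2 hf hg => s [? ?] [? ?]; split; first exact: hasD_mulmx.
by apply: hasDD; exact: hasD_mulmx.
Qed.

Lemma regular_continuous (W : normedModType R) (f : R -> W) :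
  regular f -> {for t, continuous f}.
Proof.
move=> /regularP[f1 [f2 /nbhs_singleton[[h _] _]]].
exact: differentiable_continuous.
Qed.

Lemma hasD_invmx_curve n (f : R -> 'M[R]_n) (s : R) df :
  (\forall u \near s, f u \in unitmx) -> hasD f s 1 df ->
  hasD (fun u => invmx (f u)) s 1 (- (invmx (f s) *m df *m invmx (f s))).
Proof.
(* [hasD_invmx] asks for invertibility everywhere, so [f] is replaced by the identity wherever it is
   singular, which happens only away from [s]. *)
move=> hu hf; pose h u := if f u \in unitmx then f u else 1%:M.
have fh : \forall u \near s, f u = h u by apply: filterS hu => u fu; rewrite /h fu.
have hD : hasD h s 1 df by exact: hasD_near hf.
have hU u : h u \in unitmx by rewrite /h; case: ifP => // _; exact: unitmx1.
rewrite (nbhs_singleton fh); apply: hasD_near (hasD_invmx hU hD).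
by apply: filterS fh => u ->.
Qed.

Lemma unitmx_near n (f : R -> 'M[R]_n) : {for t, continuous f} ->
  f t \in unitmx -> \forall s \near t, f s \in unitmx.
Proof.
rewrite unitmxE unitfE => fc f0.
have dc : {for t, continuous (fun s => \det (f s) : R)}.
  apply: (@continuous_comp _ _ _ f (fun A : 'M[R]_n => \det A : R)) => //.
  apply: differentiable_continuous.
  have h (s : 'S_n) : hasD (fun A : 'M[R]_n => (-1) ^+ s * \prod_i A i (s i) : R) (f t) 0 0.
    split; last exact: derive0.
    apply: differentiableM; first exact: differentiable_cst.
    by apply: differentiable_prod => i; exact: differentiable_coord.
  by have [] := hasD_sum (index_enum _) xpredT h.
have h := cvgr_neq0 _ dc f0.
near=> s; rewrite unitmxE unitfE; near: s; exact: h.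
Unshelve. all: by end_near. Qed.

Lemma regular_invmx n (f : R -> 'M[R]_n) : f t \in unitmx ->
  regular f -> regular (fun s => invmx (f s)).
Proof.
move=> ft hf; have fu := unitmx_near (regular_continuous hf) ft.
move: hf => /regularP[f1 [f2 hf]]; apply/regularP.
pose g1 s := - (invmx (f s) *m f1 s *m invmx (f s)).
exists g1, (fun s => - ((g1 s *m f1 s + invmx (f s) *m f2 s) *m invmx (f s) +
  invmx (f s) *m f1 s *m g1 s)).
apply: filterS2 (near_join fu) hf => s us [h1 h2].
have h3 := hasD_invmx_curve us h1; split => //.
by apply: hasDN; apply: hasD_mulmx => //; exact: hasD_mulmx.
Qed.

End RegularCurves.

Lemma linear_cfg_continuous (R : realType) (W : normedModType R) m n p q
    (g : {linear ('M[R]_(m, n) * 'M[R]_(p, q))%type -> W}) : continuous g.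
Proof.
apply: linear_pair_continuous.
  have l1 : linear (fun u : 'M[R]_(m, n) => g (u, 0)).
    by move=> c u v; rewrite -linearP; congr (g _); congr pair; rewrite /= scaler0 addr0.
  exact: (@linear_mx_continuous _ _ _ _ (HB.pack (fun u : 'M[R]_(m, n) => g (u, 0))
    (GRing.isLinear.Build _ _ _ _ _ l1) : {linear 'M[R]_(m, n) -> W})).
have l2 : linear (fun u : 'M[R]_(p, q) => g (0, u)).
  by move=> c u v; rewrite -linearP; congr (g _); congr pair; rewrite /= scaler0 addr0.
exact: (@linear_mx_continuous _ _ _ _ (HB.pack (fun u : 'M[R]_(p, q) => g (0, u))
  (GRing.isLinear.Build _ _ _ _ _ l2) : {linear 'M[R]_(p, q) -> W})).
Qed.

Lemma Ck_id (R : realType) (V : normedModType R) k : Ck k (fun x : V => x).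
Proof.
case: k => [|k]; first by move=> x; exact: cvg_id.
by apply: (CkS (D := fun v _ => v)) => [x v|v]; [exact: hasD_id | exact: Ck_cst].
Qed.

(** For M = C + 1, orthogonality of C reads M^T M = M + M^T, that is, M^-1 and its transpose add up
    to 1. Solving the Cayley formula for A gives A = 1 - 2 M^-1. *)
Lemma skew_of_inverse (R : realType) n (M : 'M[R]_n) :
  M \in unitmx -> M^T *m M = M + M^T ->
  (1%:M - 2 *: invmx M)^T = - (1%:M - 2 *: invmx M).
Proof.
move=> hM MM; have hMT : M^T \in unitmx by rewrite unitmx_tr.
have II : (invmx M)^T = 1%:M - invmx M.
  apply/eqP; rewrite eq_sym subr_eq eq_sym; apply/eqP.
  have := congr1 (fun X => invmx M^T *m X *m invmx M) MM.
  rewrite /= mulmxDr mulmxDl mulVmx // mul1mx !mulmxA mulVmx // mul1mx mulmxV //.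
  by rewrite -mulmxA mulmxV // mulmx1 trmx_inv => ->.
rewrite linearB linearZ /= trmx1 II scalerBr !opprB addrCA; congr (_ + _).
rewrite -{1}[1%:M]scale1r -scalerBl (_ : 1 - 2 = - 1 :> R) ?scaleN1r //.
by ring.
Qed.

(** * A chart from the Cayley transform and stereographic projection *)

Section Chart.
Variables (R : realType) (n : nat) (b : rolling_ball R n).
Hypothesis hb : admissible b.
Variables (g0 : 'M[R]_n) (r0 : 'cV[R]_n).
Hypothesis hq0 : config b (g0, r0).

(** Only the square of [dist b] is a squared length of r0 with a fixed sign for its root: [dist b]
    is negative for [OuterShell]. *)
Let d2 : R := dist b ^+ 2.
Let orth : {vspace 'cV[R]_n} := lker (linfun (mulmx r0^T)).
Let coords : vectType R := (soT R n * subvs_of orth)%type.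
Let N := dim coords.
Let chA (x : 'rV[R]_N) : 'M[R]_n := vsval (@r2v _ coords x).1.
Let chu (x : 'rV[R]_N) : 'cV[R]_n := vsval (@r2v _ coords x).2.
Let chp x : 'cV[R]_n := r0 + chu x.
(** The point p runs over the hyperplane tangent to the sphere at r0. Inversion maps it to a sphere
    through the origin, and the scaling and shift give inverse stereographic projection from - r0.
    Nothing is singular on the parameter side, so the domain is the whole space. *)
Let phi (x : 'rV[R]_N) : cfg R n :=
  (g0 *m cayley (chA x), (2 * d2) *: inversion (chp x) - r0).

Let d2_gt0 : 0 < d2. Proof. by rewrite exprn_even_gt0 //= dist_neq0. Qed.
Let r0r0 : dot r0 r0 = d2. Proof. by case: hq0. Qed.
Let g0SO : SO g0. Proof. by case: hq0. Qed.

Lemma in_orth u : (u \in orth) = (dot r0 u == 0).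
Proof.
rewrite memv_ker lfunE /= dotE; apply/eqP/eqP => [/matrixP/(_ 0 0)|->].
  by rewrite !mxE mulr1n.
by rewrite raddf0.
Qed.

Let chA_skew x : (chA x)^T = - chA x. Proof. exact: so_tr. Qed.

Let chu_orth x : dot r0 (chu x) = 0.
Proof. by apply/eqP; rewrite -in_orth subvsP. Qed.

Let chp_dot x : dot r0 (chp x) = d2.
Proof. by rewrite /chp dotDr chu_orth addr0. Qed.

Let chp_neq0 x : chp x != 0.
Proof.
apply/eqP => E; have := chp_dot x; rewrite E /dot mulmx0 mxE => /eqP.
by rewrite lt_eqF.
Qed.

Let d20 : 2 * d2 != 0. Proof. by rewrite mulf_neq0 ?pnatr_eq0 // gt_eqF. Qed.

Let hasD_chA x v : hasD chA x v (chA v).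
Proof.
exact: (hasD_mxlinear (vsval \o (fst : coords -> soT R n) \o @r2v _ coords) (hasD_id x v)).
Qed.

Let hasD_chu x v : hasD chu x v (chu v).
Proof.
exact: (hasD_mxlinear (vsval \o (snd : coords -> subvs_of orth) \o @r2v _ coords) (hasD_id x v)).
Qed.

Let hasD_chp x v : hasD chp x v (chu v).
Proof. by apply: hasD_eq (hasDD (hasD_cst r0 x v) (hasD_chu x v)) _; rewrite add0r. Qed.

Let P x := 1%:M - chA x.
Let s x := (dot (chp x) (chp x))^-1.

Let s_neq0 x : s x != 0. Proof. by rewrite invr_eq0 dotxx_eq0. Qed.

Let P_unit x : P x \in unitmx. Proof. exact: sub1_skew_unit. Qed.

Let hasD_phi x v : hasD phi x v
  (g0 *m (2 *: (invmx (P x) *m chA v *m invmx (P x))),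
   (2 * d2) *: (s x *: reflection (chp x) (chu v))).
Proof.
apply: hasD_pair.
  apply: hasD_eq (hasD_mulmx (hasD_cst g0 x v) (hasD_cayley chA_skew (hasD_chA x v))) _.
  by rewrite mul0mx add0r.
apply: hasD_eq (hasDB (hasDZ (2 * d2) (hasD_inversion chp_neq0 (hasD_chp x v))) (hasD_cst r0 x v)) _.
by rewrite subr0.
Qed.

Let Ck_phi k : Ck k.+1 phi.
Proof.
have CA : Ck k.+1 chA.
  exact: (Ck_linear (g := vsval \o (fst : coords -> soT R n) \o @r2v _ coords)
    (@linear_mx_continuous _ _ _ _ _) (Ck_id _ k.+1)).
have Cu : Ck k.+1 chu.
  exact: (Ck_linear (g := vsval \o (snd : coords -> subvs_of orth) \o @r2v _ coords)
    (@linear_mx_continuous _ _ _ _ _) (Ck_id _ k.+1)).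
have CZ m p c (f : 'rV[R]_N -> 'M[R]_(m, p)) : Ck k.+1 f -> Ck k.+1 (fun x => c *: f x).
  by move=> h; apply: (Ck_linear (g := *:%R c)) h; exact: linear_mx_continuous.
have CP : Ck k.+1 P by apply: CkD; [exact: Ck_cst | exact: CkN].
have Cp : Ck k.+1 chp by apply: CkD; [exact: Ck_cst | exact: Cu].
apply: Ck_pair.
  apply: Ck_mulmx; first exact: Ck_cst.
  apply: CkD; last exact: Ck_cst.
  by apply: (CZ n n 2 (fun x => invmx (P x))); apply: Ck_invmx.
apply: CkD; last exact: Ck_cst.
apply: (CZ n 1 (2 * d2) (fun x => inversion (chp x))).
apply: Ck_mulmx => //; apply: Ck_invmx.
  by move=> x; rewrite mx11_unit -/(dot _ _) dotxx_eq0.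
apply: Ck_mulmx => //.
by apply: (Ck_linear (g := trmx)) => //; exact: linear_mx_continuous.
Qed.

Let phi_config x : config b (phi x).
Proof.
split=> /=; first by apply: SO_mul => //; exact: cayley_SO.
rewrite -/d2 inversionE scalerA -/(s x) -scaleN1r.
rewrite dotDl !dotDr !dotZl !dotZr chp_dot (dotC _ r0) chp_dot r0r0.
rewrite -[dot (chp x) (chp x)]invrK -/(s x); field; exact: s_neq0.
Qed.

Let phi_inj x y : phi x = phi y -> x = y.
Proof.
move=> [E1 E2].
have A12 : chA x = chA y.
  have /(congr1 (mulmx g0^T)) := E1; rewrite !mulmxA g0SO.1 !mul1mx.
  move=> /addIr /(scalerI (_ : 2 != 0)) E.
  have : P x = P y by rewrite -[LHS]invmxK E ?invmxK // pnatr_eq0.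
  by move=> /addrI /oppr_inj.
have u12 : chu x = chu y.
  move: E2 => /addIr /(scalerI d20) E; apply: (addrI r0).
  by rewrite -/(chp x) -[LHS]inversionK E inversionK.
apply: (can_inj r2vK); apply: injective_projections; exact: val_inj.
Qed.

Let phi_immersion x w : 'D_w phi x = 0 -> w = 0.
Proof.
have [_ ->] := hasD_phi x w => -[E1 E2].
have A0 : chA w = 0.
  have /(congr1 (mulmx g0^T)) := E1; rewrite mulmxA g0SO.1 mul1mx mulmx0.
  move=> /eqP; rewrite scaler_eq0 pnatr_eq0 /= => /eqP E.
  have := congr1 (fun M => P x *m M *m P x) E.
  by rewrite /= mulmx0 mul0mx -!mulmxA mulVmx // mulmx1 mulKVmx.
have u0 : chu w = 0.
  have E : reflection (chp x) (chu w) = 0.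
    by apply: (scalerI (s_neq0 x)); apply: (scalerI d20); rewrite !scaler0.
  by rewrite -[LHS](reflectionK _ (chp_neq0 x)) E -[X in reflection _ X](scale0r 0) reflectionZ scale0r.
apply: (can_inj r2vK); rewrite linear0; apply: injective_projections; exact: val_inj.
Qed.

Let phi_tangent x w : config_tangent (phi x) ('D_w phi x).
Proof.
have [hd _] := hasD_phi x w; have h := hasDE w hd.
split.
  rewrite SO_inv ?in_so; last by case: (phi_config x).
  have := hasD_mulmx (hasD_trmx (hasD_fst h)) (hasD_fst h).
  have -> : (fun y => (phi y).1^T *m (phi y).1) = cst 1%:M.
    by apply/funext => y; case: (phi_config y) => -[].
  move=> [_]; rewrite derive_cst => /esym/eqP; rewrite addr_eq0 => /eqP E.
  by rewrite trmx_mul trmxK; apply/eqP.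
have := hasD_dot (hasD_snd h) (hasD_snd h).
have -> : (fun y => dot (phi y).2 (phi y).2) = cst d2.
  by apply/funext => y; case: (phi_config y).
move=> [_]; rewrite derive_cst (dotC ('D_w phi x).2) -mulr2n => /esym/eqP.
by rewrite mulrn_eq0 /= => /eqP.
Qed.

Let mkcoord (A : 'M[R]_n) (u : 'cV[R]_n) : 'rV[R]_N :=
  @v2r _ coords (vsproj (so R n) A, vsproj orth u).

Let chA_mkcoord A u : A^T = - A -> chA (mkcoord A u) = A.
Proof. by move=> h; rewrite /chA /mkcoord v2rK /= soP. Qed.

Let chu_mkcoord A u : dot r0 u = 0 -> chu (mkcoord A u) = u.
Proof. by move=> h; rewrite /chu /mkcoord v2rK /= vsprojK // in_orth h. Qed.

Let phi_submersion x v : config_tangent (phi x) v -> exists w, 'D_w phi x = v.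
Proof.
have [hx1 hx2] := phi_config x.
move=> [h1 h2]; rewrite SO_inv // in h1.
set xi := (phi x).1^T *m v.1 in h1.
have xiT : xi^T = - xi by apply/eqP; rewrite -in_so.
have v1E : v.1 = g0 *m (cayley (chA x) *m xi).
  by rewrite mulmxA -[g0 *m _]/((phi x).1) /xi mulmxA SO_mulT // mul1mx.
clearbody xi.
have PT : (P x)^T = 2%:M - P x.
  rewrite /P linearB /= trmx1 chA_skew opprK opprB addrCA -raddfB addrC.
  by congr (_%:M + _); ring.
have CE : cayley (chA x) = invmx (P x) *m (P x)^T.
  by rewrite PT mulmxBr mulVmx // mul_mx_scalar.
have h2' : dot (phi x).2 v.2 = 0 by exact: h2.
(* Both witnesses solve the formula of [hasD_phi]: [A] from 2 P^-1 A P^-1 = P^-1 P^T xi, and [u]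
   because a reflection is its own inverse. *)
pose A := 2^-1 *: ((P x)^T *m xi *m P x).
pose u := (2 * d2 * s x)^-1 *: reflection (chp x) v.2.
have AT : A^T = - A.
  by rewrite /A linearZ /= !trmx_mul trmxK xiT mulNmx mulmxN scalerN mulmxA.
(* The reflection is symmetric and sends r0 to minus the current point of the sphere, to which [v.2]
   is orthogonal. *)
have u0 : dot r0 u = 0.
  rewrite /u dotZr -reflection_dot; have -> : reflection (chp x) r0 = - (phi x).2.
    rewrite /reflection (dotC (chp x)) chp_dot -/(s x) /= inversionE -/(s x).
    by rewrite scalerA opprB; congr (_ - _ *: _); ring.
  by rewrite dotNl h2' oppr0 mulr0.
exists (mkcoord A u); have [_ ->] := hasD_phi x (mkcoord A u).
rewrite chA_mkcoord // chu_mkcoord //.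
apply: injective_projections => /=.
  have -> : 2 *: (invmx (P x) *m A *m invmx (P x)) =
      invmx (P x) *m ((P x)^T *m xi *m P x) *m invmx (P x).
    by rewrite /A -scalemxAr -scalemxAl scalerA mulfV ?pnatr_eq0 // scale1r.
  by rewrite v1E CE !mulmxA mulmxK.
rewrite /u reflectionZ reflectionK // !scalerA mulfV ?scale1r //.
by rewrite mulf_neq0.
Qed.

Lemma chart_parametrization : local_parametrization b setT phi.
Proof.
split.
- by split; [exact: openT | apply: Ck_C2_on; exact: Ck_phi].
- by move=> x _.
- by move=> x y _ _; exact: phi_inj.
- by move=> x w _; exact: phi_immersion.
- move=> x _; apply/seteqP; split=> v.
    by move=> /phi_submersion[w <-]; exists w.
  by move=> [w _ <-]; exact: phi_tangent.
Qed.

(** The inverse of the chart: C = 2 P^-1 - 1 gives P = 2 (C + 1)^-1, and r + r0 = 2 d^2 p / |p|^2 is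
    solved by inverting once more. *)
Let phi_mkcoord g r : config b (g, r) -> g0^T *m g + 1%:M \in unitmx ->
  r + r0 != 0 ->
  phi (mkcoord (1%:M - 2 *: invmx (g0^T *m g + 1%:M))
               ((2 * d2) *: inversion (r + r0) - r0)) = (g, r).
Proof.
move=> [/= hg hr] hM hz; rewrite -/d2 in hr.
set M := _ + _ in hM *; set C := g0^T *m g in M hM *.
have hC : C^T *m C = 1%:M by case: (SO_mul (SO_tr g0SO) hg).
have MM : M^T *m M = M + M^T.
  have -> : M^T = C^T + 1%:M by rewrite /M [LHS]linearD /= trmx1.
  by rewrite /M mulmxDl !mulmxDr hC !mulmx1 !mul1mx addrC [1%:M + _]addrC.
have AT := skew_of_inverse hM MM.
(* Since r and r0 have equal length, this identity places the computed p in the tangent hyperplane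
   at r0. *)
have zz : dot (r + r0) (r + r0) = 2 * dot r0 (r + r0).
  by rewrite dotDl !dotDr hr r0r0 (dotC r r0); ring.
have uT : dot r0 ((2 * d2) *: inversion (r + r0) - r0) = 0.
  rewrite dotDr dotZr -scaleN1r dotZr r0r0 inversionE dotZr.
  have : dot (r + r0) (r + r0) != 0 by rewrite dotxx_eq0.
  by rewrite zz => z0; field; move: z0; rewrite mulf_eq0 negb_or => /andP[].
rewrite /phi /chp chA_mkcoord // chu_mkcoord //; congr pair.
  have u2 : 2 *: invmx M \in unitmx.
    by rewrite unitmxZ ?unitmx_inv // unitfE pnatr_eq0.
  rewrite /cayley opprB addrCA subrr addr0 (invmxZ u2) invmxK.
  rewrite scalerA mulfV ?pnatr_eq0 // scale1r /M addrK /C mulmxA.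
  by rewrite SO_mulT // mul1mx.
by rewrite addrCA subrr addr0 inversionZ inversionK scalerA mulfV // scale1r addrK.
Qed.

Lemma chart_curve (q : R -> cfg R n) (t : R) : q t = (g0, r0) ->
  (\forall s \near t, config b (q s)) -> regular t q ->
  exists x : R -> 'rV[R]_N,
    \forall s \near t, [/\ [set: 'rV[R]_N] (x s), phi (x s) = q s & twice_derivable x s].
Proof.
move=> qt qc qr.
have rg : regular t (fun s => (q s).1) by apply: (regular_linear (g := fst)) qr => ?; exact: cvg_fst.
have rr : regular t (fun s => (q s).2) by apply: (regular_linear (g := snd)) qr => ?; exact: cvg_snd.
pose M s := g0^T *m (q s).1 + 1%:M.
pose z s := (q s).2 + r0.
pose zz s := (z s)^T *m z s.
have rM : regular t M.
  exact: (regularD (regular_mulmx (regular_cst t g0^T) rg) (regular_cst t 1%:M)).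
have rz : regular t z by exact: (regularD rr (regular_cst _ _)).
have rZ m p c (f : R -> 'M[R]_(m, p)) : regular t f -> regular t (fun s => c *: f s).
  by move=> h; apply: (regular_linear (g := *:%R c)) h; exact: linear_mx_continuous.
have rzz : regular t zz.
  have rzT := regular_linear (g := trmx) (@linear_mx_continuous _ _ _ _ trmx) rz.
  exact: (regular_mulmx rzT rz).
(* At the base instant [M] is 2 and [z] is 2 r0, so both inverses exist there and, by continuity,
   nearby. *)
have uM : M t \in unitmx.
  rewrite /M qt /= g0SO.1 -raddfD /= unitmxE det_scalar unitfE expf_neq0 //.
have uzz : zz t \in unitmx.
  rewrite mx11_unit -/(dot _ _) dotxx_eq0 /z qt /=.
  rewrite -mulr2n -scaler_nat scaler_eq0 pnatr_eq0 /= -dotxx_eq0 r0r0.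
  by rewrite gt_eqF.
exists (fun s => mkcoord (1%:M - 2 *: invmx (M s)) ((2 * d2) *: inversion (z s) - r0)).
have rx : regular t (fun s => mkcoord (1%:M - 2 *: invmx (M s)) ((2 * d2) *: inversion (z s) - r0)).
  have rA : regular t (fun s => 1%:M - 2 *: invmx (M s)).
    apply: regularD; first exact: regular_cst.
    have -> : (fun u => - (2 *: invmx (M u))) = (fun u => (- 2) *: invmx (M u)).
      by apply/funext => u; rewrite scaleNr.
    exact: (rZ _ _ _ _ (regular_invmx uM rM)).
  have ru : regular t (fun s => (2 * d2) *: inversion (z s) - r0).
    apply: regularD (regular_cst _ _); apply: (rZ _ _ _ (fun s => inversion (z s))).
    exact: (regular_mulmx rz (regular_invmx uzz rzz)).
  have ml : linear (fun v : cfg R n => mkcoord v.1 v.2).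
    move=> c v w; pose k (z : cfg R n) : coords := (vsproj (so R n) z.1, vsproj orth z.2).
    have kE : k (c *: v + w) = c *: k v + k w by rewrite /k /= !linearP.
    by rewrite /mkcoord -/(k _) kE linearP.
  pose mL : {linear cfg R n -> 'rV[R]_N} := HB.pack (fun v : cfg R n => mkcoord v.1 v.2)
    (GRing.isLinear.Build _ _ _ _ _ ml).
  exact: (regular_linear (g := mL) (@linear_cfg_continuous _ _ _ _ _ _ mL) (regular_pair rA ru)).
have nM := unitmx_near (regular_continuous rM) uM.
have nz := unitmx_near (regular_continuous rzz) uzz.
near=> u; split => //; last by near: u; exact: rx.
have [h1 h2] : config b (q u) /\ M u \in unitmx by split; near: u.
have h3 : zz u \in unitmx by near: u.
move: h1 h2 h3; rewrite /zz mx11_unit -/(dot _ _) dotxx_eq0 /z /M.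
by case: (q u) => g r /=; exact: phi_mkcoord.
Unshelve. all: by end_near. Qed.

End Chart.

Lemma chart_exists (R : realType) (n : nat) (b : rolling_ball R n) (q : R -> cfg R n) (t : R) :
  admissible b -> (\forall s \near t, config b (q s)) -> regular t q ->
  exists (N : nat) (U : set 'rV[R]_N) (phi : 'rV[R]_N -> cfg R n) (x : R -> 'rV[R]_N),
    local_parametrization b U phi /\
    \forall s \near t, [/\ U (x s), phi (x s) = q s & twice_derivable x s].
Proof.
move=> hb qc qr; have := nbhs_singleton qc.
case E : (q t) => [g0 r0] hq0.
have [x hx] := chart_curve hb hq0 E qc qr.
do 4 eexists; split; first exact: (chart_parametrization hb hq0).
exact: hx.
Qed.

(** * Equations of motion *)

Section EquationsOfMotion.
Variables (R : realType) (n : nat) (b : rolling_ball R n).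
Hypothesis hb : admissible b.
Variables (J : set R) (g : R -> 'M[R]_n) (r : R -> 'cV[R]_n)
  (m : R -> soT R n) (gam : R -> 'cV[R]_n).
Hypothesis oJ : open J.
Hypothesis gamE : forall t, J t -> gam t = gamma_of b (g t, r t).

Let q (t : R) : cfg R n := (g t, r t).

Let nearJ t (Q : R -> Prop) : J t -> (forall s, J s -> Q s) -> \forall s \near t, Q s.
Proof.
move=> Jt h; have nJ : \forall s \near t, J s by exact: open_nbhs_nbhs.
exact: filterS nJ.
Qed.

(** The multiplier is taken to be m' - [m, om]. The principle, tested on all of v_gamma, puts it in
    h_gamma; the differentiated constraint gives its defining equation. *)
Lemma motion_solution :
  motion b J q ->
  (forall t, J t -> m t = total_inertia b (omega_of (q t) (derive1 q t))) ->
  solution_G b J m g gam.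
Proof.
move=> hM mE t Jt.
have hK s : J s -> \forall u \near s, [/\ config b (q u), derivable q u 1 &
    rubber_distribution b (q u) (derive1 q u)].
  by move=> Js; apply: (nearJ Js) => u /hM[? [? _] ? _].
have [hc [hq hq'] hr hL] := hM _ Jt.
have [oE OT v1 v2 h0] := rubber_kinematics hb hc hr.
have hqD := hasD_derive1 hq; have hqD' := hasD_derive1 hq'.
have hdom := hasD_mulmx (hasD_trmx (hasD_fst hqD)) (hasD_fst hqD').
set dom := (_ + _) in hdom.
set Om := (q t).1^T *m (derive1 q t).1 in oE OT v1 v2 h0.
have gt := gamE Jt; rewrite -[gamma_of b (q t)]gt in v2 h0.
have g1 : dot (gam t) (gam t) = 1 by rewrite gt; exact: gamma_of_unit.
have omE s : J s -> omega_of_momentum b (m s) = omega_of (q s) (derive1 q s).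
  by move=> /mE ->; exact: total_inertiaK.
have opE : omega_of (q t) (derive1 q t) = vsproj (so R n) Om by rewrite -oE vsvalK.
have domT := dom_skew hb (hK _ Jt) hdom.
have domh := dom_pr_h hb (hK _ Jt) hdom; rewrite -[gamma_of b (q t)]gt in domh.
split.
  by split; [exact: hc.1 | exact: g1 | rewrite omE // oE].
pose dm := total_inertia b (vsproj (so R n) dom).
exists dm, (g t *m Om), (- eps b *: (Om *m gam t)).
have hgD : hasD g t 1 (g t *m Om) by rewrite -[g t]/((q t).1) -v1; exact: (hasD_fst hqD).
have hgamD : hasD gam t 1 (- eps b *: (Om *m gam t)).
  have h := hasD_gamma hb (hK _ Jt); rewrite -[gamma_of b (q t)]gt in h.
  by apply: hasD_near h; apply: (nearJ Jt) => s Js; rewrite gamE.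
split; [|  | exact/is_derive_hasD | exact/is_derive_hasD].
- rewrite /field_G omE // oE opE; exists (dm - lie (m t) (vsproj (so R n) Om)); split => //.
  + apply/is_lambda0E; rewrite omE // opE; split; last first.
      by rewrite addrC subrK total_inertiaK // soP.
    apply/h_spaceE => y.
    have rc : regular t q by apply: (nearJ Jt) => s /hM[].
    have cc : \forall s \near t, config b (q s) by apply: (nearJ Jt) => s /hM[].
    have [N [U [phi [x [hphi hx]]]]] := chart_exists hb cc rc.
    (* A virtual velocity with angular part y /\ gamma for arbitrary y; no-slip dictates the
       translational part. *)
    have rW : rubber_distribution b (q t) ((q t).1 *m wedge y (gam t),
        (pm b * rho b) *: ((q t).1 *m (wedge y (gam t) *m gam t))).
      rewrite gt; apply: rubber_distributionI => //; first exact: wedge_tr.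
      by rewrite pr_h_wedge // gamma_of_unit.
    have [Ut pt _] := nbhs_singleton hx.
    (* The differential of the chart is onto the tangent space, so this velocity has coordinates. *)
    have [w wE] : exists w, 'D_w phi (x t) = ((q t).1 *m wedge y (gam t),
        (pm b * rho b) *: ((q t).1 *m (wedge y (gam t) *m gam t))).
      case: rW => + _ _; case: (hphi) => _ _ _ _ /(_ _ Ut); rewrite pt => -> [w _ <-].
      by exists w.
    rewrite -wE in rW.
    have := virtual_work hb (hK _ Jt) hdom hphi hx rW.
    rewrite (hL _ _ _ _ hphi hx _ rW) wE /= mulmxA hc.1.1 mul1mx -/Om.
    by rewrite (mE _ Jt) opE => <-.
  + by rewrite addrC subrK.
- rewrite /dm; have h := so_derive_linear (total_inertia b) hdom.
  apply/is_derive_hasD; move/is_derive_hasD: h; apply: hasD_near.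
  apply: (nearJ Jt) => s Js; have [hcs _ hrs _] := hM _ Js.
  have [oEs _ _ _ _] := rubber_kinematics hb hcs hrs.
  by rewrite mE // -oEs vsvalK.
Qed.

Lemma solution_motion : solution_G b J m g gam ->
  motion b J q /\
  (forall t, J t -> m t = total_inertia b (omega_of (q t) (derive1 q t))).
Proof.
move=> hS; have d0 := dist_neq0 hb.
pose om s := omega_of_momentum b (m s).
have S1 s : J s -> [/\ SO (g s), dot (gam s) (gam s) = 1 & pr_h (gam s) (vsval (om s)) = 0].
  by move=> /hS[[]].
have hg s : J s -> hasD g s 1 (g s *m vsval (om s)).
  by move=> /hS[_ [dm [dg [dgam [[lam [_ _ -> _]] _ /is_derive_hasD]]]]].
have hgam s : J s -> hasD gam s 1 (- eps b *: (vsval (om s) *m gam s)).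
  by move=> /hS[_ [dm [dg [dgam [[lam [_ _ _ ->]] _ _ /is_derive_hasD]]]]].
have rE s : J s -> r s = dist b *: (g s *m gam s).
  by move=> Js; rewrite gamE //; apply: (gamma_ofK hb (q := q s)); case: (S1 s Js).
have hc s : J s -> config b (q s).
  move=> Js; have [h1 h2 _] := S1 s Js; split => //=.
  by rewrite rE // dotZl dotZr SO_dot // h2 mulr1 expr2.
(* The no-slip law is recovered by differentiating r = dist g gamma, since dist (1 - eps) = +/-
   rho. *)
have hr s : J s -> hasD r s 1 ((pm b * rho b) *: (g s *m (vsval (om s) *m gam s))).
  move=> Js; apply: (hasD_near (f := fun s => dist b *: (g s *m gam s))).
    by apply: (nearJ Js) => u /rE.
  apply: hasD_eq (hasDZ _ (hasD_mulmx (hg _ Js) (hgam _ Js))) _.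
  rewrite -mulmxA -mulmxDr -{1}[vsval _ *m _]scale1r -scalerDl -scalemxAr scalerA.
  by congr (_ *: _); rewrite -(pm_rho_dist hb) opprB addrCA subrr addr0 mulrC mulrA divfK.
have hq s : J s -> hasD q s 1 (g s *m vsval (om s), (pm b * rho b) *: (g s *m (vsval (om s) *m gam s))).
  by move=> Js; apply: hasD_pair; [exact: hg | exact: hr].
have q'E s : J s -> derive1 q s = (g s *m vsval (om s), (pm b * rho b) *: (g s *m (vsval (om s) *m gam s))).
  by move=> Js; exact: derive1_hasD (hq s Js).
have rub s : J s -> rubber_distribution b (q s) (derive1 q s).
  move=> Js; rewrite q'E // gamE //; apply: (rubber_distributionI hb (hc s Js)).
    exact: so_tr.
  by rewrite -gamE //; case: (S1 s Js).
have gT s : J s -> (q s).1^T *m (derive1 q s).1 = vsval (om s).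
  by move=> Js; rewrite q'E //= mulmxA; have [[-> _] _ _] := S1 s Js; rewrite mul1mx.
have oE s : J s -> omega_of (q s) (derive1 q s) = om s.
  move=> Js; have [E _ _ _ _] := rubber_kinematics hb (hc s Js) (rub s Js).
  by rewrite -[LHS]vsvalK E gT // vsvalK.
split; last by move=> t Jt; rewrite oE // omega_of_momentumK.
move=> t Jt.
have [_ [dm [dg [dgam [[lam [/is_lambda0E[l0 hl] dmE _ _]] /is_derive_hasD mD _ _]]]]] := hS t Jt.
(* The system is of first order, but the motion must be twice derivable: g' and r' are polynomial in
   g, gamma and om, and om = I^-1 m is derivable. *)
have hom : hasD (fun s => vsval (om s)) t 1 (vsval (omega_of_momentum b dm)).
  have h := hasD_mxlinear (vsval \o ((total_inertia b)^-1)%VF \o vsproj (so R n)) mD.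
  move: h; rewrite /= vsvalK; apply: hasD_ext => s /=.
  by rewrite vsvalK.
have hq' : derivable (derive1 q) t 1.
  have h1 := hasD_mulmx (hg t Jt) hom.
  have h2 := hasDZ (pm b * rho b) (hasD_mulmx (hg t Jt) (hasD_mulmx hom (hgam t Jt))).
  have nE : \forall s \near t, (g s *m vsval (om s),
      (pm b * rho b) *: (g s *m (vsval (om s) *m gam s))) = derive1 q s.
    by apply: (nearJ Jt) => s Js; rewrite q'E.
  by have [d _] := hasD_near nE (hasD_pair h1 h2); exact: diff_derivable.
have hd s : J s -> derivable q s 1.
  by move=> Js; have [d _] := hq s Js; exact: diff_derivable.
split; [exact: hc | by split; [exact: hd |] | exact: rub | ].
move=> N U phi x hphi hx w hw.
have hK : \forall u \near t, [/\ config b (q u), derivable q u 1 &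
    rubber_distribution b (q u) (derive1 q u)].
  by apply: (nearJ Jt) => u Ju; split; [exact: hc | exact: hd | exact: rub].
have hdom : hasD (fun s => (q s).1^T *m (derive1 q s).1) t 1 (vsval (omega_of_momentum b dm)).
  by apply: hasD_near hom; apply: (nearJ Jt) => s /gT.
rewrite (virtual_work hb hK hdom hphi hx hw) gT // !vsvalK !omega_of_momentumK //.
rewrite dmE -/(om t) addrAC subrr add0r.
(* The virtual work is now that of lambda_0, which annihilates gamma and hence pairs to 0 with (W
   gamma) /\ gamma. *)
have [_ WT _ _ W0] := rubber_kinematics hb (hc t Jt) hw.
move/(pr_h0E WT): W0 => ->.
by rewrite -[gamma_of b (q t)]gamE // ip_tensor ?so_tr // l0 /dot mulmx0 mxE.
Qed.

End EquationsOfMotion.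

Theorem proposition3 (R : realType) (n : nat) (b : rolling_ball R n)
    (hb : admissible b) :
  (* lambda_0 is well defined *)
  (forall (m : soT R n) (gam : 'cV[R]_n), in_G0 b m gam ->
     exists! lam : soT R n, is_lambda0 b m gam lam) /\
  (* the equations define a vector field on G *)
  (forall (m : soT R n) (g : 'M[R]_n) (gam : 'cV[R]_n)
          (dm : soT R n) (dg : 'M[R]_n) (dgam : 'cV[R]_n),
     in_G b m g gam -> field_G b m g gam dm dg dgam ->
     tangent_G b m g gam dm dg dgam) /\
  (* and they are the equations of motion *)
  (forall (J : set R) (g : R -> 'M[R]_n) (r : R -> 'cV[R]_n)
          (m : R -> soT R n) (gam : R -> 'cV[R]_n),
     open J -> is_interval J ->
     (forall t, J t -> gam t = gamma_of b (g t, r t)) ->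
     (motion b J (fun t => (g t, r t)) /\
      (forall t, J t ->
         m t = total_inertia b
           (omega_of (g t, r t) (derive1 (fun s => (g s, r s)) t))))
     <-> solution_G b J m g gam) /\
  (* the left action of SO(n) is a symmetry of the Lagrangian system *)
  (forall (a : 'M[R]_n) (q v : cfg R n), SO a -> config b q ->
     config_tangent q v ->
     [/\ config b (left_act a q) /\
           config_tangent (left_act a q) (left_act a v),
         lagrangian b (left_act a q) (left_act a v) = lagrangian b q v,
         rubber_distribution b (left_act a q) (left_act a v) <->
           rubber_distribution b q v,
         omega_of (left_act a q) (left_act a v) = omega_of q v &
         gamma_of b (left_act a q) = gamma_of b q]) /\
  (* and of the equations on G *)
  (forall (a g : 'M[R]_n) (m : soT R n) (gam : 'cV[R]_n), SO a ->
     in_G b m g gam ->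
     in_G b m (a *m g) gam /\
     forall (dm : soT R n) (dg : 'M[R]_n) (dgam : 'cV[R]_n),
       field_G b m g gam dm dg dgam ->
       field_G b m (a *m g) gam dm (a *m dg) dgam) /\
  (* (m, g, gam) |-> (m, gam) identifies G / SO(n) with G0 *)
  (forall (m : soT R n) (gam : 'cV[R]_n),
     (in_G0 b m gam <-> exists g : 'M[R]_n, in_G b m g gam) /\
     forall g g' : 'M[R]_n, in_G b m g gam -> in_G b m g' gam ->
       exists! a : 'M[R]_n, SO a /\ g' = a *m g) /\
  (* the induced system on G0 *)
  (forall (m : soT R n) (g : 'M[R]_n) (gam : 'cV[R]_n)
          (dm : soT R n) (dgam : 'cV[R]_n), in_G b m g gam ->
     ((exists dg : 'M[R]_n, field_G b m g gam dm dg dgam) <->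
      field_G0 b m gam dm dgam) /\
     (field_G0 b m gam dm dgam -> tangent_G0 b m gam dm dgam)) /\
  (forall (J : set R) (m : R -> soT R n) (g : R -> 'M[R]_n)
          (gam : R -> 'cV[R]_n), open J -> is_interval J ->
     solution_G b J m g gam <->
     solution_G0 b J m gam /\
     forall t, J t -> SO (g t) /\
       is_derive t (1 : R) g (g t *m vsval (omega_of_momentum b (m t)))).
Proof.
(* The equation for g is solved for dg at any g, so the field on G projects to G0 without loss and
   lifts back. *)
have total m g gam dm dgam : field_G0 b m gam dm dgam ->
    field_G b m g gam dm (g *m vsval (omega_of_momentum b m)) dgam.
  by move=> [lam [h1 h2 h3]]; exists lam.
refine (conj _ (conj _ (conj _ (conj _ (conj _ (conj _ (conj _ _))))))).
- by move=> m gam [g1 _]; exact: lambda0_unique_existence.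
- by move=> m g gam dm dg dgam; exact: field_G_tangent.
- move=> J g r m gam oJ _ gamE; split=> [[hM mE]|].
    exact: motion_solution hM mE.
  exact: solution_motion.
- by move=> a q v; exact: left_symmetry.
- move=> a g m gam ha [hg g1 h0]; split; first by split=> //; exact: SO_mul.
  move=> dm dg dgam [lam [h1 h2 -> h4]]; exists lam; split=> //.
  by rewrite mulmxA.
- move=> m gam; split.
    split=> [[g1 h0]|[g [_ g1 h0]]]; last by split.
    by exists 1%:M; split=> //; exact: SO_1.
  move=> g g' [hg _ _] [hg' _ _]; exists (g' *m g^T); split.
    split; first by apply: SO_mul => //; exact: SO_tr.
    by rewrite -mulmxA hg.1 mulmx1.
  by move=> a [_ ->]; rewrite -mulmxA SO_mulT // mulmx1.
- move=> m g gam dm dgam hG; split.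
    split=> [[dg [lam [h1 h2 _ h4]]]|h]; first by exists lam.
    by eexists; exact: total h.
  (* A curve in G0 is obtained from one in G by forgetting the rotation. *)
  move=> h; have [mu [k [c [h1 [h2 _ h3] h4 _ h5]]]] := field_G_tangent hb hG (total _ _ _ _ _ h).
  by exists mu, c; split=> // t; have [_ ? ?] := h1 t.
- move=> J m g gam _ _; split=> [h|[h1 h2] t Jt].
    split=> t Jt; have [[h1 h2 h3] [dm [dg [dgam [[lam [l1 l2 l3 l4]] d1 d2 d3]]]]] := h t Jt.
      by split=> //; exists dm, dgam; split=> //; exists lam.
    by split=> //; rewrite -l3.
  have [[g1 h0] [dm [dgam [f d1 d2]]]] := h1 t Jt; have [hg hd] := h2 t Jt.
  split; first by split.
  by exists dm, (g t *m vsval (omega_of_momentum b (m t))), dgam; split=> //; exact: total.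
Qed.
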